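(* Let $p\ge1$, $\varepsilon\in(0,1/4)$, $\delta\in(0,1)$. Let $\mu_1,\dots,\mu_k$ be discrete distributions on $\mathbb{R}^d$ with support size $n$, and let $X=\bigcup_i\mathrm{supp}(\mu_i)$. Let $\pi:\mathbb{R}^d\to\mathbb{R}^m$ be a random JL (standard dimensionality reduction) map with \[m=O\!\left(\frac{\log\frac n\delta+p\log\frac1\varepsilon+p^2}{\varepsilon^2}\right).\] Then with probability at least $1-\delta$, simultaneously for every solution $\mathcal{C}=(C_1,\dots,C_n)$ with corresponding weight functions $w_j$, \[\mathrm{cost}_p(\pi(\mathcal{C}))\le(1+\varepsilon)^{3p}\mathrm{cost}_p(\mathcal{C}),\qquad (1-\varepsilon)\mathrm{cost}_p(\mathcal{C})\le(1+\varepsilon)^{3p-1}\mathrm{cost}_p(\pi(\mathcal{C})).\]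
   Context: A solution $(C_1,\dots,C_n,w_1,\dots,w_n)$ comes from the optimal couplings of each $\mu_i$ to some fixed $\nu$ with support points $\nu^1,\dots,\nu^n$: $w_j(x)\ge0$ is the mass sent from point $x$ to $\nu^j$, $C_j=\{x\in X:w_j(x)>0\}$. $\mathrm{cost}_p(\mathcal{C})=\min_{\nu^j\in\mathbb{R}^d}\frac1k\sum_j\sum_{x\in C_j}w_j(x)\|x-\nu^j\|^p$ and $\mathrm{cost}_p(\pi(\mathcal{C}))=\min_{\tilde\nu^j\in\mathbb{R}^m}\frac1k\sum_j\sum_{x\in C_j}w_j(x)\|\pi(x)-\tilde\nu^j\|^p$. A random map $\pi$ is a standard dimension reduction if for all $x,y$ it preserves $\|x-y\|$ within factor $1+\varepsilon$ with probability $\ge1-\delta'$ and the expected excess $\mathbb{E}[\mathbf{1}\{\|\pi(x)-\pi(y)\|>(1+\varepsilon)\|x-y\|\}(\|\pi(x)-\pi(y)\|^p/\|x-y\|^p-(1+\varepsilon)^p)]\le\alpha$, with $\delta',\alpha\le\exp(-c\varepsilon^2m)$ for $m\ge c'p/\varepsilon^2$ (e.g. scaled Gaussian matrices). *)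

(* Defs.v *)
From HB Require Import structures.
From mathcomp Require Import all_boot all_order all_algebra finmap.
From mathcomp Require Import all_classical all_reals all_analysis.

Set Implicit Arguments.
Unset Strict Implicit.
Unset Printing Implicit Defensive.

Import Order.TTheory GRing.Theory Num.Theory.
Local Open Scope classical_set_scope.
Local Open Scope ring_scope.

(* The canonical norm `|x| on 'rV[R]_d is the sup norm,
   hence a separate Euclidean norm. *)
Definition norm2 (R : realType) (d : nat) (x : 'rV[R]_d) : R :=
  Num.sqrt (\sum_(i < d) x ord0 i ^+ 2).

(* A discrete probability distribution on R^d whose support has exactly
   n points, given by an enumeration of the support and the point masses. *)
Record discrete_dist (R : realType) (d n : nat) := DiscreteDist {
  atom : 'I_n -> 'rV[R]_d;
  mass : 'I_n -> R;
  atom_inj : injective atom;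
  mass_gt0 : forall a, 0 < mass a;
  mass_sum1 : \sum_(a < n) mass a = 1 }.

Section Solutions.
Variables (R : realType) (d n k : nat).
Implicit Types (mu nu : discrete_dist R d n).

Definition is_coupling mu nu (g : 'I_n -> 'I_n -> R) : Prop :=
  [/\ forall a j, 0 <= g a j,
      forall a, \sum_(j < n) g a j = mass mu a
    & forall j, \sum_(a < n) g a j = mass nu j].

Definition transport_cost (p : R) mu nu (g : 'I_n -> 'I_n -> R) : R :=
  \sum_(a < n) \sum_(j < n) g a j * norm2 (atom mu a - atom nu j) `^ p.

Definition is_optimal_coupling (p : R) mu nu (g : 'I_n -> 'I_n -> R) : Prop :=
  is_coupling mu nu g /\
  forall g', is_coupling mu nu g' ->
    transport_cost p mu nu g <= transport_cost p mu nu g'.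

Variable mus : 'I_k -> discrete_dist R d n.

Definition support_union : {fset 'rV[R]_d} :=
  [fset atom (mus i) a | i in 'I_k, a in 'I_n]%fset.

(* The same point x may be an atom of several of the distributions; the mass
   sent from x to the j-th atom of nu is summed over all of them. *)
Definition is_solution (p : R) (C : 'I_n -> {fset 'rV[R]_d})
    (w : 'I_n -> 'rV[R]_d -> R) : Prop :=
  exists (nu : discrete_dist R d n) (g : 'I_k -> 'I_n -> 'I_n -> R),
    [/\ forall i, is_optimal_coupling p (mus i) nu (g i),
        forall j x,
          w j x = \sum_(i < k) \sum_(a < n | atom (mus i) a == x) g i a j
      & forall j, C j = [fset x in support_union | 0 < w j x]%fset].

End Solutions.

(* The minimum over the n centers in R^m of the cost of the image under f of
   the solution (C, w); it is attained, so it is the infimum below. *)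
Definition image_cost (R : realType) (d m n k : nat) (p : R)
    (f : 'rV[R]_d -> 'rV[R]_m) (C : 'I_n -> {fset 'rV[R]_d})
    (w : 'I_n -> 'rV[R]_d -> R) : R :=
  inf [set v : R | exists c : 'I_n -> 'rV[R]_m,
    v = k%:R^-1 *
        \sum_(j < n) \sum_(x <- C j) w j x * norm2 (f x - c j) `^ p].

Definition cost (R : realType) (d n k : nat) (p : R)
    (C : 'I_n -> {fset 'rV[R]_d}) (w : 'I_n -> 'rV[R]_d -> R) : R :=
  image_cost k p id C w.

Section RandomMaps.
Variables (R : realType) (disp : measure_display) (T : measurableType disp).
Variables (P : probability T R) (d m : nat).

Definition is_random_map (pi : T -> 'rV[R]_d -> 'rV[R]_m) : Prop :=
  forall x i, measurable_fun setT (fun t => pi t x ord0 i).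

Definition preserves_dist (eps : R) (f : 'rV[R]_d -> 'rV[R]_m)
    (x y : 'rV[R]_d) : Prop :=
  (1 + eps)^-1 * norm2 (x - y) <= norm2 (f x - f y)
    <= (1 + eps) * norm2 (x - y).

(* For x = y the indicator is 0, so the quotient 0 / 0 plays no role. *)
Definition excess (eps p : R) (f : 'rV[R]_d -> 'rV[R]_m)
    (x y : 'rV[R]_d) : R :=
  ((1 + eps) * norm2 (x - y) < norm2 (f x - f y))%R%:R *
  (norm2 (f x - f y) `^ p / norm2 (x - y) `^ p - (1 + eps) `^ p).

Definition is_dim_reduction (eps p delta' alpha : R)
    (pi : T -> 'rV[R]_d -> 'rV[R]_m) : Prop :=
  forall x y,
    ((1 - delta')%:E <= P [set t | preserves_dist eps (pi t) x y])%E /\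
    ('E_P[fun t => excess eps p (pi t) x y] <= alpha%:E)%E.

Definition standard_dim_reduction (c c' eps p : R)
    (pi : T -> 'rV[R]_d -> 'rV[R]_m) : Prop :=
  is_random_map pi /\
  (c' * p / eps ^+ 2 <= m%:R ->
   exists delta' alpha : R,
     [/\ delta' <= expR (- (c * eps ^+ 2 * m%:R)),
         alpha <= expR (- (c * eps ^+ 2 * m%:R))
       & is_dim_reduction eps p delta' alpha pi]).

End RandomMaps.

(* Main.v *)
Require Import Defs.
From HB Require Import structures.
From mathcomp Require Import all_boot all_order all_algebra finmap.
From mathcomp Require Import all_classical all_reals all_analysis.
From mathcomp Require Import measurable_realfun ring lra.

Set Implicit Arguments.
Unset Strict Implicit.
Unset Printing Implicit Defensive.

Import Order.TTheory GRing.Theory Num.Theory.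
Import numFieldNormedType.Exports.
Local Open Scope classical_set_scope.
Local Open Scope ring_scope.

(* Fix a reference clustering of the atoms with n centers among the atoms,
   whose cost is at most 2^p times that of any solution. The pairs distorted
   by the map are rare; weighting each atom x by rho(x), its contribution to
   the reference cost, Markov's inequality shows that with high probability
   all atoms, up to a tiny fraction of the reference cost, are good: undistorted
   with respect to every center and to almost all of the rho-mass of every
   reference class. No union bound over the atoms occurs, so k does not enter.

   Given a center c of one cluster, a center z on the other side of the map is
   produced as in Kirszbraun's theorem, by duality, except that the dual weights
   of the atoms are capped by their rho-mass. The few distorted pairs are then
   negligible in the dual problem, and the inequality
   |f x - z| <= (1 + eps) |x - c| + error may fail only on a set of small
   rho-mass. The atoms where it fails, like the bad ones, are moved to their
   reference centers, where it holds. The argument is symmetric in the two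
   sides of the map, which gives both inequalities. *)

(** * Euclidean norm and capped Kirszbraun extension *)

Section EuclideanNorm.
Variables (R : realType) (d : nat).
Implicit Types x y z : 'rV[R]_d.

Definition dotv x y : R := \sum_(i < d) x ord0 i * y ord0 i.

Lemma dotvC x y : dotv x y = dotv y x.
Proof. by apply: eq_bigr => i _; rewrite mulrC. Qed.

Lemma dotvDl x y z : dotv (x + y) z = dotv x z + dotv y z.
Proof. by rewrite -big_split; apply: eq_bigr => i _; rewrite mxE mulrDl. Qed.

Lemma dotvZl a x y : dotv (a *: x) y = a * dotv x y.
Proof. by rewrite mulr_sumr; apply: eq_bigr => i _; rewrite mxE mulrA. Qed.

Lemma dotvDr x y z : dotv z (x + y) = dotv z x + dotv z y.
Proof. by rewrite dotvC dotvDl !(dotvC z). Qed.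

Lemma dotvZr a x y : dotv x (a *: y) = a * dotv x y.
Proof. by rewrite dotvC dotvZl dotvC. Qed.

Lemma dotvNl x y : dotv (- x) y = - dotv x y.
Proof. by rewrite -scaleN1r dotvZl mulN1r. Qed.

Lemma dotvNr x y : dotv x (- y) = - dotv x y.
Proof. by rewrite dotvC dotvNl dotvC. Qed.

Lemma dot0v x : dotv 0 x = 0.
Proof. by rewrite -(scale0r 0) dotvZl mul0r. Qed.

Lemma dotv_suml (I : finType) (F : I -> 'rV[R]_d) x :
  dotv (\sum_i F i) x = \sum_i dotv (F i) x.
Proof. by apply: (big_morph (dotv^~ x)) => [u v|]; rewrite ?dotvDl ?dot0v. Qed.

Lemma dotvv_ge0 x : 0 <= dotv x x.
Proof. by apply: sumr_ge0 => i _; rewrite -expr2 sqr_ge0. Qed.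

Lemma norm2_ge0 x : 0 <= norm2 x.
Proof. exact: sqrtr_ge0. Qed.

Lemma sqr_norm2 x : norm2 x ^+ 2 = dotv x x.
Proof.
rewrite sqr_sqrtr; first by apply: eq_bigr => i _; rewrite expr2.
by apply: sumr_ge0 => i _; exact: sqr_ge0.
Qed.

Lemma norm2N x : norm2 (- x) = norm2 x.
Proof. by rewrite /norm2; under eq_bigr do rewrite mxE sqrrN. Qed.

Lemma norm2_distC x y : norm2 (x - y) = norm2 (y - x).
Proof. by rewrite -norm2N opprB. Qed.

Lemma norm20 : norm2 (0 : 'rV[R]_d) = 0.
Proof. by rewrite /norm2 big1 ?sqrtr0// => i _; rewrite mxE expr0n. Qed.

Lemma norm2_eq0 x : (norm2 x == 0) = (x == 0).
Proof.
apply/idP/eqP => [|->]; last by rewrite norm20.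
move=> /eqP x0; have : \sum_i x ord0 i ^+ 2 == 0.
  have := sqr_norm2 x; rewrite x0 expr0n /= /dotv => x2.
  by apply/eqP; rewrite [RHS]x2; apply: eq_bigr => i _; rewrite expr2.
rewrite psumr_eq0 => [/allP xi|i _]; last exact: sqr_ge0.
apply/rowP => i; rewrite mxE.
by have := xi i; rewrite mem_index_enum sqrf_eq0 => /(_ isT)/eqP.
Qed.

Lemma dotv_norm2 x y : dotv x y <= norm2 x * norm2 y.
Proof.
have [->|y0] := eqVneq y 0; first by rewrite dotvC dot0v norm20 mulr0.
have ny : 0 < norm2 y by rewrite lt_def norm2_eq0 y0 norm2_ge0.
(* The squared norm of this vector is [norm2 y ^+ 2] times the Cauchy-Schwarz defect. *)
have := dotvv_ge0 (norm2 y ^+ 2 *: x - dotv x y *: y).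
rewrite !(dotvDl, dotvDr, dotvZl, dotvZr, dotvNl, dotvNr) -!sqr_norm2 (dotvC y).
set a := norm2 x; set b := norm2 y; set t := dotv x y => h.
have {}h : 0 <= b ^+ 2 * (a ^+ 2 * b ^+ 2 - t ^+ 2) by apply: le_trans h _; lra.
rewrite pmulr_rge0 ?exprn_gt0// subr_ge0 -exprMn in h.
apply: le_trans (ler_norm t) _.
by rewrite -(@ler_pXn2r _ 2) ?nnegrE ?mulr_ge0 ?norm2_ge0 ?normr_ge0// real_normK ?num_real.
Qed.

Lemma ler_norm2D x y : norm2 (x + y) <= norm2 x + norm2 y.
Proof.
rewrite -(@ler_pXn2r _ 2) ?nnegrE ?addr_ge0 ?norm2_ge0//.
rewrite sqr_norm2 !(dotvDl, dotvDr) -!sqr_norm2 (dotvC y).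
have := dotv_norm2 x y; nra.
Qed.

Lemma norm2_dist_triangle z x y : norm2 (x - y) <= norm2 (x - z) + norm2 (z - y).
Proof. by apply: le_trans (ler_norm2D _ _); rewrite addrA subrK. Qed.

End EuclideanNorm.

(** * Weighted variances *)

Section Variance.
Variables (R : realType) (d : nat) (I : finType).
Variables (y : I -> 'rV[R]_d) (l : I -> R).
Hypothesis l1 : \sum_i l i = 1.

Lemma sum_sqdist_point z :
  \sum_i l i * norm2 (y i - z) ^+ 2 =
  \sum_i l i * norm2 (y i) ^+ 2 - 2 * dotv (\sum_i l i *: y i) z + norm2 z ^+ 2.
Proof.
have -> : norm2 z ^+ 2 = \sum_i l i * norm2 z ^+ 2 by rewrite -mulr_suml l1 mul1r.
rewrite dotv_suml mulr_sumr -sumrB -big_split.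
apply: eq_bigr => i _ /=.
rewrite !sqr_norm2 !(dotvDl, dotvDr, dotvZl, dotvNl, dotvNr) (dotvC z); ring.
Qed.

(** Both sides are twice the variance of [y] under [l]: average [sum_sqdist_point] over the points
    [z = y i]. *)
Lemma sum_sqdist_pair :
  \sum_i \sum_j l i * l j * norm2 (y i - y j) ^+ 2 =
  2 * (\sum_i l i * norm2 (y i) ^+ 2 - norm2 (\sum_i l i *: y i) ^+ 2).
Proof.
have E i : \sum_j l i * l j * norm2 (y i - y j) ^+ 2 =
    l i * \sum_j l j * norm2 (y j) ^+ 2 +
    (l i * norm2 (y i) ^+ 2 - 2 * (l i * dotv (y i) (\sum_j l j *: y j))).
  rewrite (eq_bigr (fun j => l i * (l j * norm2 (y j - y i) ^+ 2))); last first.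
    by move=> j _; rewrite norm2_distC mulrA.
  by rewrite -mulr_sumr sum_sqdist_point (dotvC _ (y i)); ring.
rewrite (eq_bigr _ (fun i _ => E i)) big_split /= -mulr_suml l1 sumrB -mulr_sumr.
rewrite [in RHS]sqr_norm2 dotv_suml.
under [X in _ - 2 * X]eq_bigr do rewrite -dotvZl.
ring.
Qed.

(** The barycenter minimizes the weighted sum of squared distances. This is the easy direction of
    the duality: any center on one side controls the pairs on that side. *)
Lemma sum_sqdist_pair_le z : 
  \sum_i \sum_j l i * l j * norm2 (y i - y j) ^+ 2 <=
  2 * \sum_i l i * norm2 (y i - z) ^+ 2.
Proof.
rewrite sum_sqdist_pair ler_pM2l// sum_sqdist_point.
have := dotvv_ge0 (\sum_i l i *: y i - z).
rewrite !(dotvDl, dotvDr, dotvNl, dotvNr) -!sqr_norm2 (dotvC z); lra.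
Qed.

End Variance.

(** Normalized multipliers, one for each constraint on a center. Capping a multiplier amounts to
    letting its constraint be violated at a bounded price. *)
Definition capped_weights (R : realType) (I : finType) (cap l : I -> R) : Prop :=
  [/\ forall i, 0 <= l i, forall i, l i <= cap i & \sum_i l i = 1].

Section CappedCenter.
Variables (R : realType) (d : nat) (I : finType).
Variables (y : I -> 'rV[R]_d) (T cap : I -> R).

(** The dual objective: for weights of total 1, the minimum over [z] of the weighted sum of
    [norm2 (y i - z) ^+ 2 - T i], attained at the barycenter. *)
Let G (l : I -> R) : R :=
  \sum_i l i * (norm2 (y i) ^+ 2 - T i) - norm2 (\sum_i l i *: y i) ^+ 2.

Lemma continuous_sum_fun (X : topologicalType) (J : finType) (F : J -> X -> R) :
  (forall j, continuous (F j)) -> continuous (fun x => \sum_j F j x).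
Proof.
by move=> cF; apply: continuous_big => //; exact: add_continuous.
Qed.

(** The feasible weights, read as row vectors, form a closed subset of a box, hence a compact set,
    on which [G] is continuous. *)
Lemma capped_weights_max : (exists l, capped_weights cap l) ->
  exists2 l, capped_weights cap l & forall l', capped_weights cap l' -> G l' <= G l.
Proof.
move=> [l0 [l00 l0c l01]].
pose fn (v : 'rV[R]_#|I|) i := v ord0 (enum_rank i).
pose rv (l : I -> R) : 'rV[R]_#|I| := \row_j l (enum_val j).
have fnK l : fn (rv l) = l by apply/funext => i; rewrite /fn mxE enum_rankK.
have cfn i : continuous (fn^~ i) by exact: coord_continuous.
pose B := [set v : 'rV[R]_#|I| | forall j, `[0, cap (enum_val j)]%classic (v ord0 j)].
pose A := B `&` [set v | \sum_i fn v i = 1].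
have AE v : A v <-> capped_weights cap (fn v).
  split=> [[Bv v1]|[v0 vc v1]].
    by split=> // i; have := Bv (enum_rank i); rewrite /= in_itv /= enum_rankK => /andP[].
  split=> // j; rewrite /= in_itv /=.
  by rewrite -{1 2}[j]enum_valK v0 vc.
have cA : compact A.
  apply: compact_closedI; first by apply: (@rV_compact _ _ (fun j => `[0, cap (enum_val j)]%classic)) => j;
    exact: segment_compact.
  apply: (@closed_comp _ _ (fun v => \sum_i fn v i) [set x | x = 1]).
    by move=> v _; exact: continuous_sum_fun.
  exact: closed_eq.
have cG : continuous (G \o fn).
  have csum (a : I -> R) : continuous (fun v => \sum_i fn v i * a i).
    apply: (@continuous_sum_fun _ _ (fun i v => fn v i * a i)) => i v.
    exact: (cvgM (cfn i v) (cvg_cst (a i))).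
  have -> : G \o fn = fun v => \sum_i fn v i * (norm2 (y i) ^+ 2 - T i)
      - \sum_k (\sum_i fn v i * y i ord0 k) * (\sum_i fn v i * y i ord0 k).
    apply/funext => v /=; rewrite /G sqr_norm2 /dotv; congr (_ - _).
    apply: eq_bigr => k _; rewrite summxE.
    by congr (_ * _); apply: eq_bigr => i _; rewrite mxE.
  have cs2 : continuous (fun v => \sum_k
      (\sum_i fn v i * y i ord0 k) * (\sum_i fn v i * y i ord0 k)).
    apply: continuous_sum_fun => k u.
    exact: (cvgM (csum (fun i => y i ord0 k) u) (csum (fun i => y i ord0 k) u)).
  by move=> v; exact: (cvgB (csum _ v) (cs2 v)).
have [|v Av vmax] := @EVT_max_rV R _ (G \o fn) A _ cA (continuous_subspaceT cG).
  by exists (rv l0); apply/AE; rewrite fnK.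
rewrite inE in Av; exists (fn v); first exact/AE.
move=> l' hl'; rewrite -(fnK l'); apply: vmax.
by rewrite inE; apply/AE; rewrite fnK.
Qed.

(* Linear-programming form of the one-point Kirszbraun extension: the dual
   weights are capped, so the extension may fail on a set of small mass.
   The center is the barycenter of the weights maximizing the concave
   function G, and the conclusion is first-order optimality. *)
Lemma capped_center : (exists l, capped_weights cap l) ->
  (forall l, capped_weights cap l ->
    \sum_i \sum_j l i * l j * norm2 (y i - y j) ^+ 2 <= 2 * \sum_i l i * T i) ->
  exists z, forall l, capped_weights cap l ->
    \sum_i l i * norm2 (y i - z) ^+ 2 <= \sum_i l i * T i.
Proof.
move=> ne hT; have [l hl lmax] := capped_weights_max ne.
have [l0 lc l1] := hl.
pose z := \sum_i l i *: y i; exists z => l' hl'; have [l'0 l'c l'1] := hl'.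
pose b i := norm2 (y i) ^+ 2 - T i.
pose dz := \sum_i (l' i - l i) *: y i.
have dzE : dz = \sum_i l' i *: y i - z.
  by rewrite /dz /z -sumrB; apply: eq_bigr => i _; rewrite scalerBl.
(* [B] is the derivative of [G] at [l] in the direction of [l']; maximality of [l] along the segment
   makes it nonpositive. *)
pose B := \sum_i l' i * b i - \sum_i l i * b i - 2 * dotv z dz.
have step t : 0 < t -> t <= 1 -> B <= t * norm2 dz ^+ 2.
  move=> t0 t1.
  pose lt i := l i + t * (l' i - l i).
  have hlt : capped_weights cap lt.
    split=> [i|i|]; rewrite /lt.
    - have := l0 i; have := l'0 i; nra.
    - have := lc i; have := l'c i; nra.
    - by rewrite big_split /= -mulr_sumr sumrB l1 l'1 subrr mulr0 addr0.
  have := lmax _ hlt; rewrite /G -/z.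
  have -> : \sum_i lt i *: y i = z + t *: dz.
    rewrite /z /dz scaler_sumr -big_split; apply: eq_bigr => i _.
    by rewrite scalerDl scalerA.
  have -> : \sum_i lt i * (norm2 (y i) ^+ 2 - T i) =
     \sum_i l i * b i + t * (\sum_i l' i * b i - \sum_i l i * b i).
    rewrite -sumrB mulr_sumr -big_split; apply: eq_bigr => i _ /=.
    by rewrite /lt /b; ring.
  have -> : \sum_i l i * (norm2 (y i) ^+ 2 - T i) = \sum_i l i * b i by [].
  rewrite !sqr_norm2 !(dotvDl, dotvDr, dotvZl, dotvZr) (dotvC dz z) => h.
  rewrite -(ler_pM2l t0) /B; lra.
have B0 : B <= 0.
  rewrite leNgt; apply/negP => B0.
  have Q0 : 0 <= norm2 dz ^+ 2 by exact: sqr_ge0.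
  have BQ : 0 < B + norm2 dz ^+ 2 by lra.
  (* If [B] were positive, this [t] would be at most 1 and [t * norm2 dz ^+ 2] would be smaller than
     [B]. *)
  have := step (B / (B + norm2 dz ^+ 2)).
  rewrite divr_gt0// => /(_ isT); rewrite ler_pdivrMr// mul1r lerDl => /(_ Q0).
  rewrite mulrAC ler_pdivlMr//; nra.
(* The hypothesis on pairs says that the maximum of [G] is nonpositive. *)
have GT : \sum_i l i * b i <= norm2 z ^+ 2.
  have := hT _ hl; rewrite (sum_sqdist_pair _ l1) ler_pM2l// -/z.
  rewrite lerBlDr => h; rewrite /b; under eq_bigr do rewrite mulrBr.
  by rewrite sumrB lerBlDr addrC.
rewrite (sum_sqdist_point _ l'1).
have : \sum_i l' i * b i = \sum_i l' i * norm2 (y i) ^+ 2 - \sum_i l' i * T i.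
  by rewrite -sumrB; apply: eq_bigr => i _; rewrite /b mulrBr.
move: B0; rewrite /B dzE !(dotvDr, dotvNr) -!sqr_norm2 (dotvC z); lra.
Qed.

End CappedCenter.

(** * Sparsely distorted clusters *)

Section Undistorted.
Variables (R : realType) (I : finType) (d1 d2 : nat) (eps : R).

Definition undistorted (u : I -> 'rV[R]_d1) (v : I -> 'rV[R]_d2) x y : bool :=
  (norm2 (v x - v y) <= (1 + eps) * norm2 (u x - u y)) &&
  (norm2 (u x - u y) <= (1 + eps) * norm2 (v x - v y)).

Lemma undistorted_sym u v x y : undistorted u v x y = undistorted u v y x.
Proof. by rewrite /undistorted (norm2_distC (u x)) (norm2_distC (v x)). Qed.

End Undistorted.

Lemma undistortedC (R : realType) (I : finType) d1 d2 (eps : R)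
    (u : I -> 'rV[R]_d1) (v : I -> 'rV[R]_d2) x y :
  undistorted eps u v x y = undistorted eps v u x y.
Proof. by rewrite /undistorted andbC. Qed.

(* Points outside [good] are unconstrained; a good point is undistorted with
   respect to all the n centers [s b], and with respect to all but a fraction
   theta of the rho-mass of each class [a @^-1: b]. *)
Definition sparsely_distorted (R : realType) (I : finType) (n d1 d2 : nat)
    (eps theta : R) (rho : I -> R) (a : I -> 'I_n) (s : 'I_n -> I)
    (good : pred I) (u : I -> 'rV[R]_d1) (v : I -> 'rV[R]_d2) : Prop :=
  [/\ forall b b', undistorted eps u v (s b) (s b'),
      forall x b, good x -> undistorted eps u v x (s b)
    & forall x b, good x ->
        \sum_(y | (a y == b) && ~~ undistorted eps u v x y) rho y <=
        theta * \sum_(y | a y == b) rho y].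

Lemma sparsely_distortedC (R : realType) (I : finType) (n d1 d2 : nat)
    (eps theta : R) (rho : I -> R) (a : I -> 'I_n) (s : 'I_n -> I)
    (good : pred I) (u : I -> 'rV[R]_d1) (v : I -> 'rV[R]_d2) :
  sparsely_distorted eps theta rho a s good u v ->
  sparsely_distorted eps theta rho a s good v u.
Proof.
move=> [H1 H2 H3]; split=> [b b'|x b gx|x b gx]; rewrite 1?undistortedC//; first exact: H2.
by have := H3 x b gx; under eq_bigl do rewrite undistortedC.
Qed.

(** * Finding a center across the map *)

Section SparseCenter.
Variables (R : realType) (I : finType) (n d1 d2 : nat).
Variables (eps theta theta2 kappa : R) (rho om : I -> R).
Variables (a : I -> 'I_n) (s : 'I_n -> I) (good : pred I).
Variables (u : I -> 'rV[R]_d1) (v : I -> 'rV[R]_d2) (c : 'rV[R]_d1).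
Hypothesis n0 : (0 < n)%N.
Hypothesis eps_gt0 : 0 < eps.
Hypothesis eps_lt : eps < 1 / 4.
Hypothesis sp : sparsely_distorted eps theta rho a s good u v.
Hypothesis om_ge0 : forall x, 0 <= om x.
Hypothesis om_le : forall x, om x <= rho x.
Hypothesis theta_ge0 : 0 <= theta.
Hypothesis theta2_gt0 : 0 < theta2.
Hypothesis kappaE : 16 * (n%:R * (theta / theta2)) <= kappa.

Let und := undistorted eps u v.
Let D x := norm2 (u x - c).
Let r x := norm2 (u x - u (s (a x))).
Let q x := r x ^+ 2 + D x ^+ 2.
Let rhoB b := \sum_(y | a y == b) rho y.
Let center x := [exists b, s b == x].

Let rho_ge0 x : 0 <= rho x. Proof. exact: le_trans (om_ge0 x) (om_le x). Qed.
Let rhoB_ge0 b : 0 <= rhoB b. Proof. exact: sumr_ge0. Qed.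
Let q_ge0 x : 0 <= q x. Proof. by rewrite addr_ge0 ?sqr_ge0. Qed.

(** A cap of 1 is no restriction, so that the bound at the reference centers holds without
    exception. At other good points the cap is such that weights proportional to [om] on a subset of
    a class are feasible as soon as its [om]-mass exceeds [theta2 * rhoB b]. *)
Let cap x : R :=
  if center x then 1 else if good x then om x / (theta2 * rhoB (a x)) else 0.

(** The squared Kirszbraun bound plus, away from the reference centers, an error that pays for the
    distorted pairs. *)
Definition sparse_threshold x : R :=
  (1 + eps) ^+ 2 * D x ^+ 2 + (if center x then 0 else kappa * q x).

(* Both points are good, hence the detour through their centers is undistorted. *)
Lemma distorted_pair_bound x y : good x -> good y ->
  norm2 (v x - v y) ^+ 2 <= 16 * (q x + q y).
Proof.
move=> gx gy; have [Hs Hg _] := sp.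
have /andP[hx _] := Hg x (a x) gx.
have /andP[hy _] := Hg y (a y) gy.
have /andP[hxy _] := Hs (a x) (a y).
have t1 := norm2_dist_triangle (v (s (a x))) (v x) (v y).
have t2 := norm2_dist_triangle (v (s (a y))) (v (s (a x))) (v y).
have t3 := norm2_dist_triangle (u x) (u (s (a x))) (u (s (a y))).
have t4 := norm2_dist_triangle (u y) (u x) (u (s (a y))).
have t5 := norm2_dist_triangle c (u x) (u y).
rewrite (norm2_distC (u (s (a x))) (u x)) in t3.
rewrite (norm2_distC (v (s (a y))) (v y)) in t2.
rewrite (norm2_distC c (u y)) in t5.
rewrite -/(r x) -/(r y) -/(D x) -/(D y) in hx hy t1 t2 t3 t4 t5.
have rx : 0 <= r x by exact: norm2_ge0.
have ry : 0 <= r y by exact: norm2_ge0.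
have Dx : 0 <= D x by exact: norm2_ge0.
have Dy : 0 <= D y by exact: norm2_ge0.
rewrite /q.
clearbody r D.
have e0 := eps_gt0; have e1 := eps_lt.
have h : norm2 (v x - v y) <= (1 + eps) * (2 * r x + 2 * r y + D x + D y).
  have : (1 + eps) * norm2 (u (s (a x)) - u (s (a y))) <=
         (1 + eps) * (r x + r y + D x + D y).
    by rewrite ler_pM2l; lra.
  lra.
have h2 : norm2 (v x - v y) <= 5 / 4 * (2 * r x + 2 * r y + D x + D y).
  apply: le_trans h _; rewrite ler_wpM2r; lra.
(* By Cauchy-Schwarz the square of [2 * r x + 2 * r y + D x + D y] is at most 4 + 4 + 1 + 1 = 10
   times the sum of squares, and 10 * 25 / 16 < 16; [s1] to [s6] are the squares in the defect. *)
apply: (@le_trans _ _ ((5 / 4 * (2 * r x + 2 * r y + D x + D y)) ^+ 2)).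
  by rewrite ler_pXn2r// nnegrE ?norm2_ge0//; lra.
have s1 := sqr_ge0 (r x - r y).
have s2 := sqr_ge0 (D x - D y).
have s3 := sqr_ge0 (r x - 2 * D x).
have s4 := sqr_ge0 (r x - 2 * D y).
have s5 := sqr_ge0 (r y - 2 * D x).
have s6 := sqr_ge0 (r y - 2 * D y).
have : 0 <= r x ^+ 2 + r y ^+ 2 + D x ^+ 2 + D y ^+ 2 by rewrite !addr_ge0 ?sqr_ge0.
nra.
Qed.

Let e x y : R := ([&& ~~ und x y, ~~ center x & ~~ center y])%:R.

Let e_sym x y : e x y = e y x.
Proof. by rewrite /e /und undistorted_sym [~~ center x && _]andbC. Qed.

Let e_ge0 x y : 0 <= e x y. Proof. exact: ler0n. Qed.

(** In class [b] the distorted neighbors of a good point have [rho]-mass at most [theta * rhoB b],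
    and the caps bound their weights by [rho y / (theta2 * rhoB b)]; each of the [n] classes thus
    contributes at most [theta / theta2]. *)
Lemma sparse_neighbors l x : capped_weights cap l -> good x ->
  \sum_y e x y * l y <= n%:R * (theta / theta2).
Proof.
move=> [l0 lc _] gx; have [_ _ Hd] := sp.
rewrite (partition_big a xpredT)//=.
rewrite -[n in n%:R]card_ord mulr_natl -sumr_const; apply: ler_sum => b _.
have tt : 0 <= theta / theta2 by rewrite divr_ge0// ltW.
apply: (@le_trans _ _ (\sum_(y | (a y == b) && ~~ und x y) rho y / (theta2 * rhoB b))).
  rewrite [leRHS]big_mkcondr; apply: ler_sum => y /eqP ayb /=.
  rewrite /e; case: (und x y) => /=; first by rewrite mul0r.
  have d0 : 0 <= (theta2 * rhoB b)^-1 by rewrite invr_ge0 mulr_ge0 ?(ltW theta2_gt0).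
  have rr : 0 <= rho y / (theta2 * rhoB b) by rewrite mulr_ge0.
  case cx: (center x); case cy: (center y); rewrite /= ?mul0r// mul1r.
  apply: le_trans (lc y) _; rewrite /cap cy; case: ifP => // _.
  by rewrite ayb ler_wpM2r.
rewrite -mulr_suml.
(* In a class of mass 0 the convention that the inverse of 0 is 0 annihilates the quotient. *)
have [->|rb] := eqVneq (rhoB b) 0; first by rewrite mulr0 invr0 mulr0.
have {}rb : 0 < rhoB b by rewrite lt_def rb rhoB_ge0.
rewrite ler_pdivrMr ?mulr_gt0//.
apply: le_trans (Hd x b gx) _; rewrite le_eqVlt; apply/orP; left; apply/eqP.
by rewrite -/(rhoB b) mulrA divfK// gt_eqF.
Qed.

(** The hypothesis of [capped_center] for [v]. Undistorted pairs are compared with those of [u], and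
    these with the distances to [c]. The cost [16 * (q x + q y)] of a distorted pair is charged to
    its two points, each of which meets little weight of distorted neighbors. *)
Lemma sparse_pair_sum l : capped_weights cap l ->
  \sum_x \sum_y l x * l y * norm2 (v x - v y) ^+ 2 <=
  2 * \sum_x l x * sparse_threshold x.
Proof.
move=> hl; have [l0 lc l1] := hl; have [Hs Hg _] := sp.
have e0 := eps_gt0; have e1 := eps_lt.
have supp x : l x != 0 -> center x || good x.
  move=> lx; apply: contraNT lx; rewrite negb_or => /andP[cx gx].
  by have := lc x; rewrite /cap (negbTE cx) (negbTE gx) => lx0; rewrite eq_le lx0 l0.
have term x y : l x * l y * norm2 (v x - v y) ^+ 2 <=
    (1 + eps) ^+ 2 * (l x * l y * norm2 (u x - u y) ^+ 2) +
    (16 * (l x * q x * (e x y * l y)) + 16 * (l y * q y * (e y x * l x))).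
  have p1 : 0 <= 16 * (l x * q x * (e x y * l y)) by rewrite !mulr_ge0.
  have p2 : 0 <= 16 * (l y * q y * (e y x * l x)) by rewrite !mulr_ge0.
  have [->|lx] := eqVneq (l x) 0; first by rewrite !(mul0r, mulr0) !addr0.
  have [->|ly] := eqVneq (l y) 0; first by rewrite !(mul0r, mulr0) !addr0.
  have lxy : 0 <= l x * l y by rewrite mulr_ge0.
  have [/andP[hxy _]|dxy] := boolP (und x y).
    apply: (@le_trans _ _ ((1 + eps) ^+ 2 * (l x * l y * norm2 (u x - u y) ^+ 2))).
      rewrite [leRHS]mulrCA ler_wpM2l// -exprMn ler_pXn2r ?nnegrE ?norm2_ge0//.
      by rewrite mulr_ge0 ?norm2_ge0; lra.
    by lra.
  (* A reference center is undistorted with respect to every point of nonzero weight. *)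
  have ncx : ~~ center x.
    apply/negP => cx; have /existsP[b /eqP sb] := cx.
    move: dxy => /negP; apply; rewrite -sb /und undistorted_sym.
    have /orP[/existsP[b' /eqP <-]|gy] := supp y ly; first exact: Hs.
    exact: Hg.
  have ncy : ~~ center y.
    apply/negP => cy; have /existsP[b /eqP sb] := cy.
    move: dxy => /negP; apply; rewrite -sb.
    have /orP[/existsP[b' /eqP <-]|gx] := supp x lx; first exact: Hs.
    exact: Hg.
  have gx : good x by have := supp x lx; rewrite (negbTE ncx).
  have gy : good y by have := supp y ly; rewrite (negbTE ncy).
  have -> : e y x = 1 by rewrite e_sym /e dxy ncx ncy.
  have -> : e x y = 1 by rewrite /e dxy ncx ncy.
  apply: (@le_trans _ _ (l x * l y * (16 * (q x + q y)))).
    by rewrite ler_wpM2l// distorted_pair_bound.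
  have : 0 <= (1 + eps) ^+ 2 * (l x * l y * norm2 (u x - u y) ^+ 2).
    by rewrite mulr_ge0 ?sqr_ge0// mulr_ge0 ?sqr_ge0.
  lra.
apply: le_trans (ler_sum _ (fun x _ => ler_sum _ (fun y _ => term x y))) _.
under eq_bigr do rewrite 2!big_split /=.
(* After the exchange both error terms are the same sum [S]. *)
rewrite 2!big_split /= [X in _ + (_ + X) <= _]exchange_big /=.
set S := \sum_i \sum_i0 16 * _.
have S_le : S <= \sum_x l x * (if center x then 0 else kappa * q x).
  apply: ler_sum => x _; rewrite -mulr_sumr -mulr_sumr.
  have [->|lx] := eqVneq (l x) 0; first by rewrite !mul0r mulr0.
  case cx: (center x).
    rewrite big1 ?mulr0// => y _.
    by rewrite /e cx /= andbF mul0r.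
  have gx : good x by have := supp x lx; rewrite cx.
  have h : 16 * (\sum_y e x y * l y) <= kappa.
    by apply: le_trans kappaE; rewrite ler_pM2l// sparse_neighbors.
  have := ler_wpM2l (mulr_ge0 (l0 x) (q_ge0 x)) h; lra.
have V : \sum_i \sum_j l i * l j * norm2 (u i - u j) ^+ 2 <= 2 * \sum_x l x * D x ^+ 2.
  exact: sum_sqdist_pair_le.
under eq_bigr do rewrite -mulr_sumr.
rewrite -mulr_sumr.
have V2 := ler_wpM2l (sqr_ge0 (1 + eps)) V.
have -> : \sum_x l x * sparse_threshold x = (1 + eps) ^+ 2 * (\sum_x l x * D x ^+ 2) +
    \sum_x l x * (if center x then 0 else kappa * q x).
  rewrite mulr_sumr -big_split; apply: eq_bigr => x _ /=.
  by rewrite /sparse_threshold mulrDr; congr (_ + _); ring.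
lra.
Qed.

(** The averaged bound of [capped_center] is tested on two kinds of weights: a point mass at a
    reference center, and, if the violators in a class were too heavy, the weights proportional to
    [om] on them, which would contradict the bound. *)
Lemma sparse_center : exists z : 'rV[R]_d2,
  (forall b, norm2 (v (s b) - z) <= (1 + eps) * norm2 (u (s b) - c)) /\
  (forall b, \sum_(x | [&& a x == b, good x & sparse_threshold x < norm2 (v x - z) ^+ 2])
     om x <= theta2 * \sum_(y | a y == b) rho y).
Proof.
have e0 := eps_gt0; have e1 := eps_lt.
have cap1 b : cap (s b) = 1.
  by rewrite /cap ifT//; apply/existsP; exists b.
have cap_ge0 x : 0 <= cap x.
  rewrite /cap; case: ifP => // _; case: ifP => // _.
  by rewrite divr_ge0// mulr_ge0 ?(ltW theta2_gt0).
have hdelta b : capped_weights cap (fun x => (x == s b)%:R).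
  split=> [x|x|]; first exact: ler0n.
    by case: eqP => [->|_]; rewrite ?cap1.
  by rewrite (bigD1 (s b))//= eqxx big1 ?addr0// => i /negbTE ->.
have sdelta b (F : I -> R) : \sum_x (x == s b)%:R * F x = F (s b).
  rewrite (bigD1 (s b))//= eqxx mul1r big1 ?addr0// => i /negbTE ->.
  by rewrite mul0r.
have ne : exists l, capped_weights cap l by eexists; exact: (hdelta (Ordinal n0)).
have [z hz] := capped_center ne sparse_pair_sum.
have zc b : norm2 (v (s b) - z) ^+ 2 <= (1 + eps) ^+ 2 * norm2 (u (s b) - c) ^+ 2.
  have := hz _ (hdelta b); rewrite !sdelta /sparse_threshold.
  have -> : center (s b) by apply/existsP; exists b.
  by rewrite addr0.
exists z; split=> b.
  have := zc b; rewrite -exprMn ler_pXn2r// nnegrE ?norm2_ge0//.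
  by rewrite mulr_ge0 ?norm2_ge0//; lra.
pose V x := [&& a x == b, good x & sparse_threshold x < norm2 (v x - z) ^+ 2].
rewrite -/(rhoB b) leNgt; apply/negP => big.
pose S := \sum_(x | V x) om x; rewrite -/S in big.
have S0 : 0 < S by apply: le_lt_trans big; rewrite mulr_ge0 ?(ltW theta2_gt0).
have rb : 0 < rhoB b.
  rewrite lt_def rhoB_ge0 andbT; apply/eqP => rb0.
  suff : S <= 0 by rewrite leNgt S0.
  rewrite -rb0 /S /rhoB [leRHS]big_mkcond [leLHS]big_mkcond /=.
  apply: ler_sum => x _; rewrite /V; case: (a x == b) => //=; case: ifP => //.
have Vnc x : V x -> center x = false.
  move=> /and3P[_ _ vx]; apply: contraTF vx => cx.
  rewrite /sparse_threshold cx addr0; have /existsP[b' /eqP <-] := cx.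
  by rewrite -leNgt zc.
pose l x := if V x then om x / S else 0.
have l_ge0 x : 0 <= l x by rewrite /l; case: ifP => // _; rewrite divr_ge0// ltW.
have hl : capped_weights cap l.
  split=> // [x|]; rewrite /l.
    case: ifP => // Vx; have /and3P[/eqP axb gx _] := Vx; rewrite /cap gx axb Vnc//.
    by rewrite ler_wpM2l// lef_pV2 ?posrE ?mulr_gt0// ltW.
  by rewrite -big_mkcond -mulr_suml mulfV// gt_eqF.
have [x /andP[Vx ox]] : exists x, V x && (0 < om x).
  apply/existsP; apply: contraLR S0; rewrite negb_exists -leNgt => /forallP no.
  rewrite /S; apply: sumr_le0 => x Vx; have := no x.
  by rewrite Vx /= -leNgt.
have := hz _ hl; apply/negP; rewrite -ltNge.
rewrite (bigD1 x)//= [ltRHS](bigD1 x)//=; apply: ltr_leD.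
  have /and3P[_ _ vx] := Vx.
  by rewrite ltr_pM2l// /l Vx divr_gt0.
apply: ler_sum => y _; rewrite /l; case: ifP => [|_]; last by rewrite !mul0r.
by move=> /and3P[_ _ vy]; rewrite ler_wpM2l ?(ltW vy)// divr_ge0// ltW.
Qed.

End SparseCenter.

(** * Power inequalities *)

Section PowerInequalities.
Variables (R : realType) (p eps : R).
Hypothesis p1 : 1 <= p.
Hypothesis eps_gt0 : 0 < eps.
Hypothesis eps_lt : eps < 1 / 4.

Let p_ge0 : 0 <= p. Proof. exact: le_trans p1. Qed.

Lemma le_powR2 x y : 0 <= x -> x <= y -> x `^ p <= y `^ p.
Proof.
by move=> x0 xy; apply: ge0_ler_powR; rewrite ?nnegrE//; exact: le_trans xy.
Qed.

(** Convexity of the power: [x + y] is the average of [(1 + eps) * x] and [(1 + eps) / eps * y] with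
    weights [1 / (1 + eps)] and [eps / (1 + eps)]. *)
Lemma powRD_le x y : 0 <= x -> 0 <= y ->
  (x + y) `^ p <= (1 + eps) `^ (p - 1) * x `^ p + ((1 + eps) / eps) `^ (p - 1) * y `^ p.
Proof.
move=> x0 y0; have e0 := eps_gt0.
pose k : R := 1 + eps; have k0 : 0 < k by rewrite /k; lra.
have t0 : 0 <= k^-1 by rewrite invr_ge0 ltW.
have t1 : k^-1 <= 1 by rewrite invf_le1// /k; lra.
have kx : 0 <= k * x by rewrite mulr_ge0// ltW.
have ke : 0 < k / eps by rewrite divr_gt0.
have ky : 0 <= k / eps * y by rewrite mulr_ge0// ltW.
have E1 : 1 - k^-1 = (k / eps)^-1 by rewrite invf_div /k; field; lra.
have : (k^-1 * (k * x) + (1 - k^-1) * (k / eps * y)) `^ p <=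
    k^-1 * (k * x) `^ p + (1 - k^-1) * (k / eps * y) `^ p.
  by apply: (@convex_powR R p p1 (Itv01 t0 t1)); rewrite inE/= in_itv/= andbT.
rewrite E1 [k^-1 * (k * x)]mulrA mulVf ?gt_eqF// mul1r.
rewrite [(k/eps)^-1 * (_ * y)]mulrA mulVf ?gt_eqF// mul1r.
rewrite (powRM p (ltW k0) x0) (powRM p (ltW ke) y0).
have B z : 0 < z -> z^-1 * z `^ p = z `^ (p - 1).
  by move=> z0; rewrite -(mulr_powRB1 (ltW z0) (lt_le_trans ltr01 p1)) mulKf// gt_eqF.
by rewrite 2!mulrA !B.
Qed.

Lemma eps_powR_gt0 : 0 < eps `^ p. Proof. exact: powR_gt0. Qed.

Lemma eps_powR_le : eps `^ p <= eps.
Proof. have e1 := eps_lt; apply: ge1r_powR p1; rewrite eps_gt0; lra. Qed.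

Lemma four_powR_eps : 4 `^ p * eps `^ p <= 1.
Proof.
have e1 := eps_lt; have e0 := eps_gt0.
rewrite -powRM ?(ltW e0)//; apply: le_trans (_ : 1 `^ p <= _); last by rewrite powR1.
by apply: le_powR2; [rewrite mulr_ge0// ltW | lra].
Qed.

Lemma two_powR_sqr : (2 : R) `^ p * 2 `^ p = 4 `^ p.
Proof. by rewrite -powRM//; congr (_ `^ _); rewrite -natrM. Qed.

Lemma two_powR_ge1 : 1 <= (2 : R) `^ p.
Proof. by rewrite -[leLHS](congr1 (@^~ p) (powR1 R)) le_powR2// ler1n. Qed.

Lemma onep_div_powR : ((1 + eps) / eps) `^ (p - 1) <= 2 `^ p / eps `^ p.
Proof.
have e1 := eps_lt; have e0 := eps_gt0.
apply: (@le_trans _ _ (((1 + eps) / eps) `^ p)).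
  by apply: ler_powR; [rewrite ler_pdivlMr// mul1r; lra | lra].
apply: (@le_trans _ _ ((2 / eps) `^ p)).
  apply: le_powR2; first by rewrite divr_ge0 ?(ltW e0)//; lra.
  by rewrite ler_pM2r ?invr_gt0//; lra.
rewrite powRM ?invr_ge0 ?(ltW e0)// -[eps^-1]powR_inv1 ?(ltW e0)//.
by rewrite -powRrM mulN1r powRN.
Qed.

(** Origin of the exponent [3 * p - 1]: [p - 1] from the splitting in [powRD_le] and [2 * p] from a
    factor [(1 + eps) ^+ 2] on distances. *)
Lemma onep_powR_combine :
  (1 + eps) `^ (p - 1) * ((1 + eps) ^+ 2) `^ p = (1 + eps) `^ (3 * p - 1).
Proof.
have e0 := eps_gt0; have k0 : 0 < 1 + eps by lra.
rewrite -powR_mulrn ?(ltW k0)// -powRrM -powRD; last by rewrite (gt_eqF k0) implybT.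
by congr (_ `^ _); lra.
Qed.

End PowerInequalities.

(** * Transfer of clustering costs across the map *)

Section ClusterTransfer.
Variables (R : realType) (I : finType) (n d1 d2 : nat) (p eps : R).
Variables (W r0 : I -> R) (w : 'I_n -> I -> R).
Variables (a : I -> 'I_n) (s : 'I_n -> I) (good : pred I).
Variables (u : I -> 'rV[R]_d1) (v : I -> 'rV[R]_d2).
Let h := eps `^ p.
(** The variable [r0] is kept apart from [ru] and [rv] so that the masses stay the same when the two
    sides are exchanged. *)
Let rho x := W x * r0 x `^ p.
Let ru x := norm2 (u x - u (s (a x))).
Let rv x := norm2 (v x - v (s (a x))).

Hypothesis n0 : (0 < n)%N.
Hypothesis p1 : 1 <= p.
Hypothesis eps_gt0 : 0 < eps.
Hypothesis eps_lt : eps < 1 / 4.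
Hypothesis sp : sparsely_distorted eps (h ^+ 25 / n%:R ^+ 2) rho a s good u v.
Hypothesis w_ge0 : forall j x, 0 <= w j x.
Hypothesis w_sum : forall x, \sum_j w j x = W x.
Hypothesis r0_ge0 : forall x, 0 <= r0 x.
Hypothesis good_ru : forall x, good x -> ru x <= (1 + eps) * r0 x.
Hypothesis good_rv : forall x, good x -> rv x <= (1 + eps) * r0 x.
Hypothesis bad_mass :
  \sum_(x | ~~ good x) W x * (ru x + rv x) `^ p <= h ^+ 7 * \sum_x rho x.

Let h_gt0 : 0 < h. Proof. exact: eps_powR_gt0. Qed.
Let h_le : h <= eps. Proof. exact: eps_powR_le. Qed.

(** Three cases: a good point obeying the threshold has an error of order [eps ^+ 8 * r0 x]; a
    violator and a bad point reach [z] through their reference center, at a price of order [r0 x]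
    and [ru x + rv x] respectively. *)
Lemma cluster_transfer_pointwise c z x (viol : bool) :
  (forall b, norm2 (v (s b) - z) <= (1 + eps) * norm2 (u (s b) - c)) ->
  (good x -> ~~ viol ->
     norm2 (v x - z) ^+ 2 <= sparse_threshold eps (eps ^+ 16) a s u c x) ->
  norm2 (v x - z) `^ p <= (1 + eps) `^ (3 * p - 1) * norm2 (u x - c) `^ p +
   2 `^ p / h * (2 `^ p * h ^+ 8 * r0 x `^ p +
     ((~~ good x)%:R * (4 `^ p * (ru x + rv x) `^ p) +
      (good x && viol)%:R * (4 `^ p * r0 x `^ p))).
Proof.
move=> hc hx; have e1 := eps_lt; have e0' := eps_gt0.
set D := norm2 (u x - c).
have D0 : 0 <= D by exact: norm2_ge0.
have ru0 : 0 <= ru x by exact: norm2_ge0.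
have rv0 : 0 <= rv x by exact: norm2_ge0.
have r00 := r0_ge0 x.
have k0 : 0 < 1 + eps by lra.
(* Once the distance is at most [(1 + eps) ^+ 2 * D + e], [powRD_le] separates the two terms. *)
suff [e [e_ge0 he hep]] : exists e : R, [/\ 0 <= e,
    norm2 (v x - z) <= (1 + eps) ^+ 2 * D + e &
    e `^ p <= 2 `^ p * h ^+ 8 * r0 x `^ p +
     ((~~ good x)%:R * (4 `^ p * (ru x + rv x) `^ p) +
      (good x && viol)%:R * (4 `^ p * r0 x `^ p))].
  apply: le_trans (le_powR2 p1 (norm2_ge0 _) he) _.
  apply: le_trans (powRD_le p1 eps_gt0 _ e_ge0) _.
    by rewrite mulr_ge0// exprn_ge0// ltW.
  rewrite powRM ?exprn_ge0 ?(ltW k0)// mulrA onep_powR_combine// lerD2l.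
  apply: ler_pM => //; try exact: powR_ge0.
  exact: onep_div_powR.
have far e : 0 <= e -> ru x + rv x <= e ->
    norm2 (v x - z) <= (1 + eps) ^+ 2 * D + (1 + eps) ^+ 2 * e.
  move=> e_ge0 he.
  have t1 := norm2_dist_triangle (v (s (a x))) (v x) z.
  have t2 := norm2_dist_triangle (u x) (u (s (a x))) c.
  rewrite (norm2_distC _ (u x)) -/(ru x) -/D in t2.
  rewrite -/(rv x) in t1.
  have t3 := hc (a x).
  have : (1 + eps) * norm2 (u (s (a x)) - c) <= (1 + eps) * (ru x + D).
    by rewrite ler_pM2l.
  have : (1 + eps) * (ru x + D) <= (1 + eps) ^+ 2 * (ru x + D).
    by rewrite ler_wpM2r ?addr_ge0// expr2 ler_peMr; lra.
  have : rv x <= (1 + eps) ^+ 2 * rv x by rewrite ler_peMl// exprn_ege1; lra.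
  have : (1 + eps) ^+ 2 * (ru x + rv x) <= (1 + eps) ^+ 2 * e.
    by rewrite ler_pM2l ?exprn_gt0.
  lra.
have nn0 : 0 <= 2 `^ p * h ^+ 8 * r0 x `^ p.
  by rewrite !mulr_ge0 ?powR_ge0// exprn_ge0 ?powR_ge0.
case gx : (good x); rewrite /= ?gx.
  have rux := good_ru gx; have rvx := good_rv gx.
  case vx : viol; rewrite /= mul0r add0r ?mul1r ?mul0r ?addr0.
    (* Both [ru x] and [rv x] are at most [(1 + eps) * r0 x]; the resulting factor is below 4, as 2
       * 125 / 64 < 4. *)
    exists ((1 + eps) ^+ 2 * (2 * (1 + eps) * r0 x)); split.
    - by rewrite !mulr_ge0// ?exprn_ge0; lra.
    - by apply: far; [rewrite !mulr_ge0//; lra | lra].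
    - apply: (@le_trans _ _ (4 `^ p * r0 x `^ p)); last by rewrite lerDr.
      rewrite -powRM//; apply: le_powR2 => //.
        by rewrite !mulr_ge0// ?exprn_ge0; lra.
      rewrite mulrA ler_wpM2r//.
      have : (1 + eps) ^+ 3 <= (5 / 4) ^+ 3 by rewrite lerXn2r ?nnegrE; lra.
      by rewrite [(5/4) ^+ 3]exprS expr2; lra.
  have E0 : 0 <= eps ^+ 8 := exprn_ge0 8 (ltW e0').
  have Ekr0 : 0 <= eps ^+ 8 * ((1 + eps) * r0 x) := mulr_ge0 E0 (mulr_ge0 (ltW k0) r00).
  have kD0 : 0 <= (1 + eps) ^+ 2 * D := mulr_ge0 (exprn_ge0 2 (ltW k0)) D0.
  (* The factor [eps ^+ 8] is the square root of [eps ^+ 16] in the threshold; the part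
     [eps ^+ 16 * D ^+ 2] is absorbed by replacing [1 + eps] with its square. *)
  exists (eps ^+ 8 * ((1 + eps) * r0 x)); split => //.
  - have := hx gx; rewrite vx => /(_ isT) hN.
    rewrite -(@ler_pXn2r _ 2) ?nnegrE ?norm2_ge0//; last exact: addr_ge0.
    apply: le_trans hN _; rewrite /sparse_threshold -/D -/(ru x).
    have q0 : 0 <= eps ^+ 16 * (ru x ^+ 2 + D ^+ 2).
      by rewrite mulr_ge0 ?addr_ge0 ?sqr_ge0// exprn_ge0 ?(ltW e0').
    apply: (@le_trans _ _ ((1 + eps) ^+ 2 * D ^+ 2 + eps ^+ 16 * (ru x ^+ 2 + D ^+ 2))).
      by rewrite lerD2l; case: ifP.
    have e16 : eps ^+ 16 <= eps.
      by rewrite exprS ler_piMr ?(ltW e0')// exprn_ile1; lra.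
    have e16' : 0 <= eps ^+ 16 by rewrite exprn_ge0 ?(ltW e0').
    have e88 : eps ^+ 16 = eps ^+ 8 * eps ^+ 8 by rewrite -exprD.
    have k4 : (1 + eps) ^+ 2 + eps ^+ 16 <= (1 + eps) ^+ 2 * (1 + eps) ^+ 2 by nra.
    have := ler_wpM2r (sqr_ge0 D) k4.
    have ru2 : ru x ^+ 2 <= ((1 + eps) * r0 x) ^+ 2.
      by rewrite lerXn2r ?nnegrE// mulr_ge0// ltW.
    have := ler_wpM2l e16' ru2.
    have c0 := mulr_ge0 kD0 Ekr0.
    move: c0; rewrite e88; set E := eps ^+ 8; set K := (1 + eps); lra.
  - have -> : 2 `^ p * h ^+ 8 * r0 x `^ p = (2 * eps ^+ 8 * r0 x) `^ p.
      rewrite (powRM p (mulr_ge0 (ler0n _ 2) E0) r00) (powRM p (ler0n _ 2) E0).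
      congr (_ * _ * _).
      by rewrite -(powR_mulrn 8 (powR_ge0 eps p)) -(powR_mulrn 8 (ltW e0')) powRAC.
    apply: (le_powR2 p1 Ekr0).
    by rewrite mulrA [eps ^+ 8 * _]mulrC ler_wpM2r// ler_wpM2r//; lra.
exists ((1 + eps) ^+ 2 * (ru x + rv x)); split.
- by rewrite !mulr_ge0 ?addr_ge0 ?exprn_ge0//; lra.
- by apply: far; rewrite ?addr_ge0.
- rewrite mul1r mul0r addr0; apply: (@le_trans _ _ (4 `^ p * (ru x + rv x) `^ p)).
    rewrite -powRM ?addr_ge0//; apply: le_powR2 => //.
      by rewrite !mulr_ge0 ?addr_ge0 ?exprn_ge0//; lra.
    by rewrite ler_wpM2r ?addr_ge0//; nra.
  by rewrite lerDr.
Qed.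

(** Each [c j] is moved by [sparse_center], with [om] the share of [rho] that cluster [j] receives.
    The errors [E1], [E2], [E3] come from all points, from bad points and from violators. *)
Lemma cluster_transfer (c : 'I_n -> 'rV[R]_d1) : exists z : 'I_n -> 'rV[R]_d2,
  \sum_j \sum_x w j x * norm2 (v x - z j) `^ p <=
  (1 + eps) `^ (3 * p - 1) * (\sum_j \sum_x w j x * norm2 (u x - c j) `^ p) +
  eps / 2 `^ p * \sum_x rho x.
Proof.
have e1 := eps_lt; have e0' := eps_gt0; have h0 := h_gt0; have hle := h_le.
have nR : (0 : R) < n%:R by rewrite ltr0n.
(* Over [n] clusters the violators then carry at most a fraction [h ^+ 7] of the mass, while
   [n%:R * (th / th2)] is [h ^+ 18], where [h ^+ 2] cancels the factor 16 and [h ^+ 16] is at most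
   [eps ^+ 16]. *)
pose th := h ^+ 25 / n%:R ^+ 2; pose th2 := h ^+ 7 / n%:R.
have th_ge0 : 0 <= th by rewrite divr_ge0 ?exprn_ge0 ?(ltW h0)// ltW.
have th2_gt0 : 0 < th2 by rewrite divr_gt0 ?exprn_gt0.
have kap : 16 * (n%:R * (th / th2)) <= eps ^+ 16.
  have -> : n%:R * (th / th2) = h ^+ 18.
    by rewrite /th /th2; field; rewrite !gt_eqF.
  rewrite (_ : h ^+ 18 = h ^+ 2 * h ^+ 16) -?exprD// mulrA.
  have H16 : h ^+ 16 <= eps ^+ 16 by rewrite lerXn2r ?nnegrE ?(ltW h0) ?(ltW e0').
  have H16' : 0 <= h ^+ 16 by rewrite exprn_ge0 ?(ltW h0).
  have : 16 * h ^+ 2 <= 1 by nra.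
  move=> H2; have := ler_wpM2r H16' H2; lra.
have r0p x : 0 <= r0 x `^ p by exact: powR_ge0.
have om_le j x : w j x * r0 x `^ p <= rho x.
  rewrite /rho ler_wpM2r// -w_sum (bigD1 j)//= lerDl; exact: sumr_ge0.
have zj j := sparse_center (c j) n0 eps_gt0 eps_lt sp
  (fun x => mulr_ge0 (w_ge0 j x) (r0p x)) (om_le j) th_ge0 th2_gt0 kap.
pose z j := projT1 (cid (zj j)).
have zc j := (projT2 (cid (zj j))).1; have zv j := (projT2 (cid (zj j))).2.
rewrite -/(z _) in zc zv.
exists z.
pose V j x := sparse_threshold eps (eps ^+ 16) a s u (c j) x < norm2 (v x - z j) ^+ 2.
pose E1 x := 2 `^ p * h ^+ 8 * r0 x `^ p.
pose E2 x := (~~ good x)%:R * (4 `^ p * (ru x + rv x) `^ p).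
pose E3 j x := (good x && V j x)%:R * (4 `^ p * r0 x `^ p).
have pw j x : w j x * norm2 (v x - z j) `^ p <=
   (1 + eps) `^ (3 * p - 1) * (w j x * norm2 (u x - c j) `^ p) +
   2 `^ p / h * (w j x * E1 x + (w j x * E2 x + w j x * E3 j x)).
  have hx : good x -> ~~ V j x ->
     norm2 (v x - z j) ^+ 2 <= sparse_threshold eps (eps ^+ 16) a s u (c j) x.
    by move=> _; rewrite /V -leNgt.
  have := ler_wpM2l (w_ge0 j x) (cluster_transfer_pointwise (zc j) hx).
  by rewrite -/(E1 x) -/(E2 x) -/(E3 j x); lra.
apply: le_trans (ler_sum _ (fun j _ => ler_sum _ (fun x _ => pw j x))) _.
under eq_bigr do rewrite big_split /= -!mulr_sumr.
rewrite big_split /= -!mulr_sumr lerD2l.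
have -> : \sum_j \sum_x (w j x * E1 x + (w j x * E2 x + w j x * E3 j x)) =
    \sum_j \sum_x w j x * E1 x +
    (\sum_j \sum_x w j x * E2 x + \sum_j \sum_x w j x * E3 j x).
  by rewrite -!big_split /=; apply: eq_bigr => j _; rewrite -!big_split.
have S1 : \sum_j \sum_x w j x * E1 x = 2 `^ p * h ^+ 8 * \sum_x rho x.
  rewrite exchange_big /= mulr_sumr; apply: eq_bigr => x _.
  by rewrite -mulr_suml w_sum /E1 /rho; ring.
have S2 : \sum_j \sum_x w j x * E2 x <= 4 `^ p * h ^+ 7 * \sum_x rho x.
  rewrite exchange_big /= -mulrA; apply: le_trans (ler_wpM2l (powR_ge0 _ _) bad_mass).
  rewrite mulr_sumr [leRHS]big_mkcond /=; apply: ler_sum => x _.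
  rewrite -mulr_suml w_sum /E2; case: ifP => _; rewrite ?mul0r ?mulr0//.
  by rewrite mul1r mulrCA.
have S3 : \sum_j \sum_x w j x * E3 j x <= 4 `^ p * h ^+ 7 * \sum_x rho x.
  have S3j j : \sum_x w j x * E3 j x <= 4 `^ p * (th2 * \sum_x rho x).
    rewrite (partition_big a xpredT)//= [X in th2 * X](partition_big a xpredT)//=.
    rewrite !mulr_sumr; apply: ler_sum => b _.
    apply: le_trans (ler_wpM2l (powR_ge0 _ _) (zv j b)).
    rewrite mulr_sumr [leRHS]big_mkcond [leLHS]big_mkcond /=; apply: ler_sum => x _.
    case: (a x == b) => //=; rewrite /E3 -/(V j x).
    by case: (good x && V j x); rewrite ?mul0r ?mulr0// mul1r mulrCA.
  apply: le_trans (ler_sum _ (fun j _ => S3j j)) _.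
  rewrite sumr_const card_ord -mulr_natl /th2 le_eqVlt; apply/orP; left; apply/eqP.
  by field; rewrite gt_eqF.
have rho0 : 0 <= \sum_x rho x.
  apply: sumr_ge0 => x _; rewrite mulr_ge0// -w_sum; exact: sumr_ge0.
set Q := \sum_x rho x in S1 S2 S3 rho0 *.
rewrite S1.
have P2 := two_powR_ge1 p1 (R := R).
have P4 := four_powR_eps p1 eps_gt0 eps_lt; rewrite -two_powR_sqr -/h in P4.
rewrite -two_powR_sqr in S2 S3.
set t := 2 `^ p in S1 S2 S3 P2 P4 *.
have t0 : 0 < t by lra.
(* Since [t * t * h <= 1], the powers of [t] are absorbed by powers of [h]; what remains is at most
   [3 * h ^+ 4], below [eps]. *)
have key : t / h * (t * h ^+ 8 + 2 * (t * t * h ^+ 7)) <= eps / t.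
  rewrite ler_pdivlMr//.
  have -> : t / h * (t * h ^+ 8 + 2 * (t * t * h ^+ 7)) * t =
     (t * t * h) * (t * h) * h ^+ 5 + 2 * (t * t * h) ^+ 2 * h ^+ 4.
    by field; rewrite gt_eqF.
  have th1 : t * h <= 1 by apply: le_trans P4; rewrite ler_pM2r// ler_peMr// ltW.
  set A := t * t * h in P4 *.
  have A0 : 0 <= A by rewrite /A !mulr_ge0 ?ltW.
  have th0 : 0 <= t * h by rewrite mulr_ge0 ?ltW.
  have A1 : A * (t * h) <= 1 by rewrite mulr_ile1.
  have A2 : A ^+ 2 <= 1 by rewrite exprn_ile1.
  have h5 : h ^+ 5 <= h ^+ 4 by rewrite (exprD h 1 4) ler_piMl ?exprn_ge0 ?exprn_ile1 ?ltW//; lra.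
  have h4' : h ^+ 3 <= (1 / 4) ^+ 3 by rewrite lerXn2r ?nnegrE ?ltW//; lra.
  have h4 : 3 * h ^+ 4 <= eps.
    rewrite exprS; move: h4'; rewrite [(1/4)^+3]exprS expr2; nra.
  have : A * (t * h) * h ^+ 5 <= h ^+ 5 by rewrite ler_piMl// exprn_ge0// ltW.
  have : A ^+ 2 * h ^+ 4 <= h ^+ 4 by rewrite ler_piMl// exprn_ge0// ltW.
  lra.
apply: le_trans (ler_wpM2r rho0 key).
rewrite -[leRHS]mulrA ler_pM2l ?divr_gt0//.
lra.
Qed.

End ClusterTransfer.

(** * Probability bounds *)

Section MeanBounds.
Variables (R : realType) (disp : measure_display) (T : measurableType disp).
Variable P : probability T R.

(** Measurability and nonnegativity are bundled with the bound, so that bounds add up without side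
    conditions. *)
Definition mean_le (f : T -> R) (b : R) : Prop :=
  [/\ measurable_fun setT f, forall t, 0 <= f t & (\int[P]_t (f t)%:E <= b%:E)%E].

Lemma mean_leZ k f b : 0 <= k -> mean_le f b -> mean_le (fun t => k * f t) (k * b).
Proof.
move=> k0 [mf f0 fb]; split=> [|t|]; first exact: measurable_funM.
  exact: mulr_ge0.
under eq_integral do rewrite EFinM.
rewrite ge0_integralZl_EFin//;
  [|by move=> t _; rewrite lee_fin|exact/measurable_EFinP].
by rewrite EFinM; apply: lee_wpmul2l.
Qed.

Lemma mean_leD f g b c : mean_le f b -> mean_le g c ->
  mean_le (fun t => f t + g t) (b + c).
Proof.
move=> [mf f0 fb] [mg g0 gc]; split=> [|t|]; first exact: measurable_funD.
  exact: addr_ge0.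
under eq_integral do rewrite EFinD.
rewrite ge0_integralD//;
  [|by move=> t _; rewrite lee_fin|exact/measurable_EFinP
   |by move=> t _; rewrite lee_fin|exact/measurable_EFinP].
by rewrite EFinD; apply: leeD.
Qed.

Lemma mean_le_sum (J : finType) (F : J -> T -> R) (b : J -> R) :
  (forall j, mean_le (F j) (b j)) ->
  mean_le (fun t => \sum_j F j t) (\sum_j b j).
Proof.
move=> hF; elim: (index_enum J) => [|j r IH].
  rewrite big_nil; under eq_fun do rewrite big_nil.
  by split=> //; rewrite integral0.
rewrite big_cons; under eq_fun do rewrite big_cons.
exact: mean_leD.
Qed.

(** Markov's inequality at level 1. *)
Lemma mean_le_event f b : mean_le f b ->
  exists E : set T, [/\ measurable E, ((1 - b)%:E <= P E)%E & forall t, E t -> f t < 1].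
Proof.
move=> [mf f0 fb].
pose A := [set t | f t < 1].
have mE : measurable A.
  rewrite -[A]setTI.
  have -> : A = (fun t => f t < 1) @^-1` [set true] by [].
  exact: measurable_fun_ltr.
exists A; split=> //.
have mC : measurable (~` A) by exact: measurableC.
have PC : (P (~` A) <= b%:E)%E.
  apply: le_trans fb; rewrite -[leLHS]mul1e -[X in (X * _)%E]/(1%:E).
  have -> : ~` A = setT `&` [set t | (1%:E <= `|(f t)%:E|)%E].
    rewrite setTI; apply/seteqP; split => t /=; rewrite lee_fin ger0_norm//.
      by move=> /negP; rewrite -leNgt.
    by move=> h; apply/negP; rewrite -leNgt.
  apply: le_trans (@le_integral_comp_abse _ _ _ P _ measurableT (EFin \o f)
    1 id _ _ _ _ _) _ => //; first exact/measurable_EFinP.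
  rewrite [leLHS](eq_integral (fun t => (f t)%:E))// => t _ /=.
  by rewrite ger0_norm.
have := probability_setC P mE => PE.
have PEf : P A \is a fin_num by exact: fin_num_measure.
move: PC; rewrite PE -(fineK PEf) -EFinB !lee_fin; lra.
Qed.

End MeanBounds.

(** * Distortion and excess of the random map *)

Section RandomMapBounds.
Variables (R : realType) (disp : measure_display) (T : measurableType disp).
Variables (P : probability T R) (d m : nat) (pi : T -> 'rV[R]_d -> 'rV[R]_m).
Variables (eps p q delta' alpha : R).
Hypothesis eps_gt0 : 0 < eps.
Hypothesis p1 : 1 <= p.
Hypothesis mpi : is_random_map pi.
Hypothesis hpi : is_dim_reduction P eps p delta' alpha pi.
Hypothesis delta'q : delta' <= q.
Hypothesis alphaq : alpha <= q.

Lemma measurable_norm2_pi x y :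
  measurable_fun setT (fun t => norm2 (pi t x - pi t y)).
Proof.
apply: measurableT_comp; first exact: continuous_measurable_fun (@sqrt_continuous R).
apply: measurable_sum => i; apply: measurable_funX.
under eq_fun do rewrite !mxE.
by apply: measurable_funB; exact: mpi.
Qed.

Variables (I : finType) (pt : I -> 'rV[R]_d).

Lemma preserves_distE t x y : preserves_dist eps (pi t) (pt x) (pt y) <->
  undistorted eps pt (fun x => pi t (pt x)) x y.
Proof.
have k0 : 0 < 1 + eps by rewrite addr_gt0.
rewrite /preserves_dist /undistorted andbC.
by rewrite ler_pdivrMl.
Qed.

Lemma mean_le_distorted x y :
  mean_le P (fun t => (~~ undistorted eps pt (fun x => pi t (pt x)) x y)%:R) q.
Proof.
pose A := [set t | preserves_dist eps (pi t) (pt x) (pt y)].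
have mA : measurable A.
  have -> : A = (fun t => undistorted eps pt (fun x => pi t (pt x)) x y) @^-1` [set true].
    by apply/seteqP; split => t /= /preserves_distE.
  rewrite -[X in measurable X]setTI.
  have mn := measurable_norm2_pi (pt x) (pt y).
  by apply: measurable_and => //; apply: measurable_fun_ler => //;
    apply: measurable_funM.
have mC : measurable (~` A) by exact: measurableC.
have E : (fun t => (~~ undistorted eps pt (fun x => pi t (pt x)) x y)%:R) = \1_(~` A) :> (T -> R).
  apply/funext => t; rewrite indicE; congr ((nat_of_bool _)%:R); apply/idP/idP.
    by move=> h; rewrite inE /= => /preserves_distE; apply/negP.
  by rewrite inE /= => h; apply/negP => /preserves_distE.
rewrite E; split=> [|t|]; [exact: measurable_indic | by rewrite indicE ler0n|].
rewrite integral_indic// setIT [leLHS](probability_setC P mA).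
have [h _] := hpi (pt x) (pt y).
have PEf : P A \is a fin_num by exact: fin_num_measure.
by move: h delta'q; rewrite -/A -(fineK PEf) -EFinB !lee_fin; lra.
Qed.

Lemma excess_ge0 (f : 'rV[R]_d -> 'rV[R]_m) x y : 0 <= excess eps p f x y.
Proof.
rewrite /excess; case: ltP => [lt|_]; last by rewrite mul0r.
have p0 : 0 < p by exact: lt_le_trans p1.
have k0 : 0 < 1 + eps by rewrite addr_gt0.
rewrite mul1r subr_ge0.
have [xy|xy] := eqVneq x y; first by move: lt; rewrite xy !subrr !norm20 mulr0 ltxx.
have nxy : 0 < norm2 (x - y) by rewrite lt_def norm2_eq0 subr_eq0 xy norm2_ge0.
rewrite ler_pdivlMr ?powR_gt0// -powRM ?norm2_ge0 ?(ltW k0)//.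
by apply: ge0_ler_powR; rewrite ?nnegrE ?norm2_ge0 ?mulr_ge0 ?norm2_ge0 ?(ltW k0) ?(ltW p0)// ltW.
Qed.

Lemma mean_le_excess x y : mean_le P (fun t => excess eps p (pi t) x y) q.
Proof.
split=> [|t|]; last 1 first.
- have [_] := hpi x y; rewrite unlock => h; apply: le_trans h _.
  by rewrite lee_fin.
- have mn := measurable_norm2_pi x y.
  apply: measurable_funM.
    apply: (@measurableT_comp _ _ _ _ _ _ (fun b : bool => b%:R : R)) => //.
    by apply: measurable_fun_ltr.
  apply: measurable_funB => //; apply: measurable_funM => //.
  exact: (measurableT_comp (measurable_powR p) mn).
- exact: excess_ge0.
Qed.

(** Either the distance grows by at most the factor [1 + eps], or the excess makes this an
    equality. *)
Lemma powR_le_excess (f : 'rV[R]_d -> 'rV[R]_m) x y :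
  norm2 (f x - f y) `^ p <= ((1 + eps) `^ p + excess eps p f x y) * norm2 (x - y) `^ p.
Proof.
rewrite /excess; have k0 : 0 < 1 + eps by rewrite addr_gt0.
have p0 : 0 < p by exact: lt_le_trans p1.
case: ltP => [lt|le]; last first.
  rewrite mul0r addr0 -powRM ?norm2_ge0 ?(ltW k0)//.
  by apply: ge0_ler_powR; rewrite ?nnegrE ?norm2_ge0 ?mulr_ge0 ?norm2_ge0 ?(ltW k0) ?(ltW p0).
have [xy|xy] := eqVneq x y; first by move: lt; rewrite xy !subrr !norm20 mulr0 ltxx.
have nxy : 0 < norm2 (x - y) by rewrite lt_def norm2_eq0 subr_eq0 xy norm2_ge0.
by rewrite mul1r (addrC ((1 + eps) `^ p)) subrK divfK// gt_eqF// powR_gt0.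
Qed.

End RandomMapBounds.

(* The reference clustering is optimal among those with centers in the point
   set; moving the centers of any clustering to their nearest points at most
   doubles the distances, whence the factor 2^p. *)
Lemma reference_clustering (R : realType) (I : finType) (n d : nat) (p : R)
    (pt : I -> 'rV[R]_d) (W : I -> R) (i0 : I) :
  (0 < n)%N -> 1 <= p ->
  exists (s : 'I_n -> I) (a : I -> 'I_n), forall (w : 'I_n -> I -> R) c,
    (forall j x, 0 <= w j x) -> (forall x, \sum_j w j x = W x) ->
    \sum_x W x * norm2 (pt x - pt (s (a x))) `^ p <=
    2 `^ p * \sum_j \sum_x w j x * norm2 (pt x - c j) `^ p.
Proof.
move=> n0 p1; pose j0 := Ordinal n0.
(* The minimizer depends only on [pt] and [W], so one reference serves all solutions. *)
pose F (sa : {ffun 'I_n -> I} * {ffun I -> 'I_n}) :=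
  \sum_x W x * norm2 (pt x - pt (sa.1 (sa.2 x))) `^ p.
case: (@arg_minP _ R _ ([ffun=> i0], [ffun=> j0]) xpredT F isT) => sa _ samin.
exists sa.1, sa.2 => w c w0 wW.
have exmin (J : finType) (k : J) (f : J -> R) : exists j, forall j', f j <= f j'.
  by case: (@arg_minP _ R _ k xpredT f isT) => j _ hj; exists j => j'; exact: hj.
have [near nearP] := choice (fun j => exmin I i0 (fun x => norm2 (pt x - c j))).
have [cls clsP] := choice (fun x => exmin _ j0 (fun j => norm2 (pt x - pt (near j)))).
apply: le_trans (samin (finfun near, finfun cls) isT) _.
rewrite /F /= exchange_big mulr_sumr; apply: ler_sum => x _ /=.
rewrite -wW mulr_suml mulr_sumr; apply: ler_sum => j _.
rewrite mulrCA ler_wpM2l// !ffunE -powRM ?norm2_ge0//.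
apply: le_powR2 => //; first exact: norm2_ge0.
apply: le_trans (clsP x j) _.
apply: le_trans (norm2_dist_triangle (c j) _ _) _.
rewrite (norm2_distC (c j)); have := nearP j x; lra.
Qed.

(** Arithmetic of [displaced_mass]: [A] and [B] stand for the powers of the two distances, [g] for
    the excess, [t] for the power of 2 and [hi] for [h^-1]. *)
Lemma displaced_arith (R : realType) (A B g k t hi : R) :
  0 <= A -> 1 <= t -> 0 <= g -> k <= t -> B <= (k + g) * A -> t * t <= hi ->
  t * (A + B) <= 2 * hi * (A * (1 + g)).
Proof.
move=> A0 t1 g0 kt BA tt.
have t0 : 0 <= t by lra.
have H1 : (k + g) * A <= (t + g) * A by rewrite ler_wpM2r// lerD2r.
have H2 : (1 + (t + g)) * A <= 2 * t * (1 + g) * A by rewrite ler_wpM2r//; nra.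
have H3 : A + B <= 2 * t * (1 + g) * A by lra.
have := ler_wpM2l t0 H3.
have K0 : 0 <= (1 + g) * A by rewrite mulr_ge0//; lra.
have := ler_wpM2r K0 tt; lra.
Qed.

(** * The good event *)

Section GoodEvent.
Variables (R : realType) (disp : measure_display) (T : measurableType disp).
Variables (P : probability T R) (d m n : nat) (pi : T -> 'rV[R]_d -> 'rV[R]_m).
Variables (I : finType) (pt : I -> 'rV[R]_d) (W : I -> R).
Variables (s : 'I_n -> I) (a : I -> 'I_n).
Variables (p eps delta q delta' alpha : R).
Let h := eps `^ p.
Let v t x := pi t (pt x).
Let und t := undistorted eps pt (v t).
Let r0 x := norm2 (pt x - pt (s (a x))).
Let rho x := W x * r0 x `^ p.
Let O := \sum_x rho x.
Let rhoB b := \sum_(y | a y == b) rho y.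
Let th := h ^+ 25 / n%:R ^+ 2.

Hypothesis n0 : (0 < n)%N.
Hypothesis p1 : 1 <= p.
Hypothesis eps_gt0 : 0 < eps.
Hypothesis eps_lt : eps < 1 / 4.
Hypothesis W_ge0 : forall x, 0 <= W x.
Hypothesis mpi : is_random_map pi.
Hypothesis hpi : is_dim_reduction P eps p delta' alpha pi.
Hypothesis delta'q : delta' <= q.
Hypothesis alphaq : alpha <= q.
Hypothesis q_ge0 : 0 <= q.
Hypothesis q_le : q * (n%:R ^+ 3 * h^-1 ^+ 35) <= delta.

Let rho_ge0 x : 0 <= rho x. Proof. by rewrite mulr_ge0// powR_ge0. Qed.
Let O_ge0 : 0 <= O. Proof. exact: sumr_ge0. Qed.
Let rhoB_ge0 b : 0 <= rhoB b. Proof. exact: sumr_ge0. Qed.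
Let h_gt0 : 0 < h. Proof. exact: eps_powR_gt0. Qed.
Let h_le : h <= 1 / 4. Proof. by apply: le_trans (ltW eps_lt); exact: eps_powR_le. Qed.
Let nR : (0 : R) < n%:R. Proof. by rewrite ltr0n. Qed.
Let th_gt0 : 0 < th. Proof. by rewrite divr_gt0 ?exprn_gt0. Qed.

Let F x y t : R := (~~ und t x y)%:R.
Let G x t : R := excess eps p (pi t) (pt x) (pt (s (a x))).
(** A linear surrogate for badness: a distorted center contributes 1, and so does, at least, a
    distorted [rho]-mass above [th * rhoB b] in class [b]. *)
Let B x t := \sum_b F x (s b) t + \sum_y rho y / (th * rhoB (a y)) * F x y t.
Let Y t := \sum_x rho x * (B x t + G x t).
(** The first sum counts distorted pairs of centers, so [Z t < 1] excludes them, and it also bounds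
    [Y t] by [h ^+ 9 * O]. *)
Let Z t := \sum_b \sum_b' F (s b) (s b') t + (h ^+ 9 * O)^-1 * Y t.

Let coef_ge0 y : 0 <= rho y / (th * rhoB (a y)).
Proof. by rewrite divr_ge0// mulr_ge0// ltW. Qed.
Let F_ge0 x y t : 0 <= F x y t. Proof. exact: ler0n. Qed.
Let B_ge0 x t : 0 <= B x t.
Proof. by rewrite addr_ge0 ?sumr_ge0// => y _; rewrite mulr_ge0. Qed.
Let G_ge0 x t : 0 <= G x t. Proof. exact: excess_ge0. Qed.

Lemma class_weights_sum : \sum_y rho y / (th * rhoB (a y)) <= n%:R / th.
Proof.
rewrite (partition_big a xpredT)//= mulrC.
rewrite -[n in n%:R]card_ord mulr_natr -sumr_const; apply: ler_sum => b _.
rewrite (eq_bigr (fun y => rho y / (th * rhoB b))) => [|y /eqP <-//].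
rewrite -mulr_suml -/(rhoB b).
have [->|rb] := eqVneq (rhoB b) 0; first by rewrite mul0r invr_ge0 ltW.
by rewrite invfM mulrCA mulfV// mulr1.
Qed.

(** Linearity of the mean, each indicator and each excess having mean at most [q]. Normalizing by
    [O] and by the class masses removes the number of atoms from the bound. *)
Lemma mean_le_bad_mass : mean_le P Z delta.
Proof.
have mF x y : mean_le P (F x y) q by exact: mean_le_distorted.
have mG x : mean_le P (G x) q by exact: mean_le_excess.
have mB x : mean_le P (B x) (n%:R * q + n%:R / th * q).
  have [m1 m2 m3] := @mean_leD _ _ _ P _ _ _ _ (mean_le_sum (fun b : 'I_n => mF x (s b)))
    (mean_le_sum (fun y => mean_leZ (coef_ge0 y) (mF x y))).
  split=> //; apply: le_trans m3 _; rewrite lee_fin; apply: lerD.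
    by rewrite sumr_const card_ord mulr_natl.
  by rewrite -mulr_suml ler_wpM2r// class_weights_sum.
have mY := mean_le_sum (fun x => mean_leZ (rho_ge0 x) (mean_leD (mB x) (mG x))).
have mS := mean_le_sum (fun b : 'I_n => mean_le_sum (fun b' : 'I_n => mF (s b) (s b'))).
have hO0 : 0 <= (h ^+ 9 * O)^-1 by rewrite invr_ge0 mulr_ge0// exprn_ge0// ltW.
have [z1 z2 z3] := mean_leD mS (mean_leZ hO0 mY).
split=> //; apply: le_trans z3 _; rewrite lee_fin; apply: le_trans q_le.
rewrite -mulr_suml -/O.
have OO : (h ^+ 9 * O)^-1 * (O * (n%:R * q + n%:R / th * q + q)) <=
    h^-1 ^+ 9 * (n%:R * q + n%:R / th * q + q).
  rewrite mulrA; apply: ler_wpM2r.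
    by rewrite !addr_ge0 ?mulr_ge0 ?invr_ge0// ltW.
  have [->|O0] := eqVneq O 0; first by rewrite mulr0 exprn_ge0// invr_ge0 ltW.
  by rewrite invfM mulfVK// exprVn.
apply: le_trans (lerD (lexx _) OO) _.
have -> : \sum_(b < n) \sum_(b' < n) q = n%:R * n%:R * q.
  by rewrite !sumr_const card_ord -[q *+ n]mulr_natl -[(_ * q) *+ n]mulr_natl mulrA.
have -> : n%:R / th = n%:R ^+ 3 * h^-1 ^+ 25.
  by rewrite /th exprVn; field; rewrite !gt_eqF// exprn_gt0.
have x4 : 4 <= h^-1.
  rewrite -[4]invrK lef_pV2 ?posrE// ?invr_gt0//.
  by apply: le_trans h_le _; lra.
have N1 : (1 : R) <= n%:R by rewrite ler1n.
move: x4 N1; set x := h^-1; set N := n%:R => x4 N1.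
have x34 : 0 <= x ^+ 34 by rewrite exprn_ge0//; lra.
have x1 : 1 <= x by lra.
have N3 : 1 <= N ^+ 3 by rewrite exprn_ege1.
(* Each of the four terms is at most [N ^+ 3 * x ^+ 34], and [4 <= x] pays for their number. *)
have hle : N * N + x ^+ 9 * (N + N ^+ 3 * x ^+ 25 + 1) <= N ^+ 3 * x ^+ 35.
  have x9 : 0 <= x ^+ 9 by rewrite exprn_ge0//; lra.
  have e1 : N * N <= N ^+ 3 * x ^+ 34.
    apply: (@le_trans _ _ (N ^+ 3)); last by rewrite ler_peMr// ?exprn_ege1//; lra.
    by rewrite -expr2 ler_weXn2l.
  have NN : N <= N ^+ 3 by rewrite ler_eXnr.
  have x925 : x ^+ 9 <= x ^+ 34 by rewrite ler_weXn2l.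
  have e2 : x ^+ 9 * N <= N ^+ 3 * x ^+ 34 by rewrite mulrC ler_pM//; lra.
  have e3 : x ^+ 9 <= N ^+ 3 * x ^+ 34.
    by apply: le_trans x925 _; rewrite ler_peMl.
  have e4 : x ^+ 9 * (N ^+ 3 * x ^+ 25) = N ^+ 3 * x ^+ 34 by rewrite mulrCA -exprD.
  have e5 : 4 * (N ^+ 3 * x ^+ 34) <= N ^+ 3 * x ^+ 35.
    by rewrite [x ^+ 35]exprS [leRHS]mulrCA ler_wpM2r// mulr_ge0//; lra.
  rewrite !mulrDr mulr1 e4; lra.
apply: le_trans (ler_wpM2l q_ge0 hle).
by rewrite le_eqVlt; apply/orP; left; apply/eqP; ring.
Qed.

Lemma bad_point_weight t x :
  ~~ ([forall b, und t x (s b)] &&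
      [forall b, \sum_(y | (a y == b) && ~~ und t x y) rho y <= th * rhoB b]) ->
  1 <= B x t.
Proof.
have p2 : 0 <= \sum_y rho y / (th * rhoB (a y)) * F x y t.
  by apply: sumr_ge0 => y _; rewrite mulr_ge0.
rewrite negb_and => /orP[/forallPn[b nb]|/forallPn[b nb]].
  rewrite /B -[1]addr0 lerD//.
  have -> : 1 = F x (s b) t by rewrite /F nb.
  by rewrite (bigD1 b)//= lerDl sumr_ge0.
rewrite -ltNge in nb.
have le_rho : \sum_(y | (a y == b) && ~~ und t x y) rho y <= rhoB b.
  rewrite big_mkcondr; apply: ler_sum => y _; by case: ifP.
have rb : 0 < rhoB b.
  rewrite lt_def rhoB_ge0 andbT; apply/eqP => rb0.
  by move: (lt_le_trans nb le_rho); rewrite rb0 mulr0 ltxx.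
rewrite /B -[1]add0r lerD ?sumr_ge0//.
apply: (@le_trans _ _ (\sum_(y | (a y == b) && ~~ und t x y) rho y / (th * rhoB b))).
  by rewrite -mulr_suml ler_pdivlMr ?(mulr_gt0 th_gt0 rb)// mul1r ltW.
rewrite [leLHS]big_mkcond; apply: ler_sum => y _ /=.
case: ifP => [/andP[/eqP -> nu]|_]; last by rewrite mulr_ge0.
by rewrite /F nu mulr1.
Qed.

(** The sum of distances costs a factor $2^p$, the excess bounds the image distance with another
    $2^p$, and [h^-1] absorbs both. *)
Lemma displaced_mass t x :
  W x * (r0 x + norm2 (v t x - v t (s (a x)))) `^ p <=
  2 * h^-1 * (rho x * (1 + G x t)).
Proof.
have e1 := eps_lt; have e0 := eps_gt0.
set rv := norm2 _.
have r00 : 0 <= r0 x by exact: norm2_ge0.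
have rv0 : 0 <= rv by exact: norm2_ge0.
have ra : 0 <= r0 x `^ p by exact: powR_ge0.
have rb : 0 <= rv `^ p by exact: powR_ge0.
have P2 := two_powR_ge1 p1 (R := R).
have H1 : (r0 x + rv) `^ p <= 2 `^ p * (r0 x `^ p + rv `^ p).
  have [le|/ltW le] := leP (r0 x) rv.
    apply: (@le_trans _ _ ((2 * rv) `^ p)); first by apply: (le_powR2 p1); lra.
    by rewrite powRM// ler_wpM2l ?powR_ge0// lerDr.
  apply: (@le_trans _ _ ((2 * r0 x) `^ p)); first by apply: (le_powR2 p1); lra.
  by rewrite powRM// ler_wpM2l ?powR_ge0// lerDl.
have H2 : rv `^ p <= ((1 + eps) `^ p + G x t) * r0 x `^ p by exact: powR_le_excess.
have H3 : (1 + eps) `^ p <= 2 `^ p by apply: (le_powR2 p1); lra.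
have H4 : 2 `^ p * 2 `^ p <= h^-1.
  have := four_powR_eps p1 e0 e1; rewrite -two_powR_sqr -/h.
  by rewrite -ler_pdivlMr// mul1r.
rewrite /rho -[W x * _ * _]mulrA [leRHS]mulrCA ler_wpM2l//.
apply: le_trans H1 _.
exact: (displaced_arith ra P2 (G_ge0 x t) H3 H2 H4).
Qed.

(** When [Z t < 1], bad points have [1 <= B x t], so their displaced mass is at most
    [2 * h^-1 * Y t], hence at most [2 * h ^+ 8 * O], and [2 * h <= 1]. *)
Lemma good_event : exists E : set T,
  [/\ measurable E, ((1 - delta)%:E <= P E)%E & forall t, E t ->
    exists2 good : pred I,
      sparsely_distorted eps th rho a s good pt (v t) &
      \sum_(x | ~~ good x) W x * (r0 x + norm2 (v t x - v t (s (a x)))) `^ p <=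
        h ^+ 7 * \sum_x rho x].
Proof.
have [E [mE PE EZ]] := mean_le_event mean_le_bad_mass.
exists E; split=> // t Et; have Zt := EZ t Et.
have Y0 : 0 <= Y t by apply: sumr_ge0 => x _; rewrite mulr_ge0// addr_ge0.
have hO0 : 0 <= (h ^+ 9 * O)^-1 by rewrite invr_ge0 mulr_ge0// exprn_ge0// ltW.
have S0 : 0 <= \sum_b \sum_b' F (s b) (s b') t.
  by apply: sumr_ge0 => b _; exact: sumr_ge0.
have hOY0 : 0 <= (h ^+ 9 * O)^-1 * Y t by rewrite mulr_ge0.
exists (fun x => [forall b, und t x (s b)] &&
  [forall b, \sum_(y | (a y == b) && ~~ und t x y) rho y <= th * rhoB b]).
  split=> [b b'|x b /andP[/forallP ub _]|x b /andP[_ /forallP ub]]; last 2 first.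
  - exact: ub.
  - exact: ub.
  apply: contraLR Zt => nb; rewrite -leNgt /Z -[1]addr0 lerD//.
  have -> : 1 = F (s b) (s b') t by rewrite /F /und nb.
  rewrite (bigD1 b)//= (bigD1 b')//= -addrA lerDl addr_ge0 ?sumr_ge0// => i _.
  by rewrite sumr_ge0.
have YO : Y t <= h ^+ 9 * O.
  (* If [O = 0], the normalization in [Z] says nothing, but every [rho x] vanishes and so does
     [Y t]. *)
  have [E0|E0] := eqVneq O 0.
    have r00 x : rho x = 0.
      by apply: (@psumr_eq0P _ _ xpredT rho) => // i _.
    by rewrite E0 mulr0 /Y big1// => x _; rewrite r00 mul0r.
  have hO : 0 < h ^+ 9 * O by rewrite mulr_gt0 ?exprn_gt0// lt_def E0 O_ge0.
  have : (h ^+ 9 * O)^-1 * Y t <= 1 by move: Zt; rewrite /Z; lra.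
  by rewrite mulrC ler_pdivrMr// mul1r.
apply: (@le_trans _ _ (2 * h^-1 * Y t)); last first.
  apply: (@le_trans _ _ (2 * h^-1 * (h ^+ 9 * O))).
    by rewrite ler_wpM2l// mulr_ge0// invr_ge0 ltW.
  rewrite mulrA ler_wpM2r//.
  have -> : 2 * h^-1 * h ^+ 9 = 2 * h * h ^+ 7 by field; rewrite gt_eqF.
  by rewrite ler_piMl ?exprn_ge0 ?ltW//; have := h_le; lra.
rewrite /Y mulr_sumr [leLHS]big_mkcond; apply: ler_sum => x _ /=.
have c0 : 0 <= 2 * h^-1 by rewrite mulr_ge0// invr_ge0 ltW.
case: ifP => [bad|_]; last first.
  exact: (mulr_ge0 c0 (mulr_ge0 (rho_ge0 x) (addr_ge0 (B_ge0 x t) (G_ge0 x t)))).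
apply: le_trans (displaced_mass t x) _.
by rewrite ler_wpM2l// ler_wpM2l// lerD2r bad_point_weight.
Qed.

End GoodEvent.

(** * Costs of solutions *)

Section Costs.
Variables (R : realType) (d n k : nat) (p : R).
Variables (mus : 'I_k -> discrete_dist R d n).
Variables (C : 'I_n -> {fset 'rV[R]_d}) (w : 'I_n -> 'rV[R]_d -> R).
Variable g : 'I_k -> 'I_n -> 'I_n -> R.
Hypothesis g_ge0 : forall i a j, 0 <= g i a j.
Hypothesis wE : forall j x,
  w j x = \sum_(i < k) \sum_(a < n | atom (mus i) a == x) g i a j.
Hypothesis CE : forall j, C j = [fset x in support_union mus | 0 < w j x]%fset.

(** Indexing by pairs counts a point once for each distribution that contains it and replaces the
    union of supports by a finite type. *)
Definition pooled_atom (x : 'I_k * 'I_n) : 'rV[R]_d := atom (mus x.1) x.2.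
Definition pooled_weight (j : 'I_n) (x : 'I_k * 'I_n) : R := g x.1 x.2 j.

Lemma solution_sum j (phi : 'rV[R]_d -> R) :
  \sum_(x <- C j) w j x * phi x =
  \sum_x pooled_weight j x * phi (pooled_atom x).
Proof.
have w_ge0 x : 0 <= w j x by rewrite wE; do 2!apply: sumr_ge0 => ? _.
transitivity (\sum_(x <- support_union mus) w j x * phi x).
  (* Points of the union outside [C j] have weight 0. *)
  rewrite CE big_fset /= [RHS](bigID (fun x => 0 < w j x)) /= [X in _ + X]big1 ?addr0//.
  move=> x; rewrite -leNgt => w0.
  by rewrite (_ : w j x = 0) ?mul0r//; apply/eqP; rewrite eq_le w0 w_ge0.
have -> : \sum_(x <- support_union mus) w j x * phi x =
    \sum_(x <- support_union mus) \sum_(y : 'I_k * 'I_n | pooled_atom y == x)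
      pooled_weight j y * phi (pooled_atom y).
  apply: eq_bigr => x _; rewrite wE pair_big_dep /= mulr_suml.
  by apply: eq_bigr => y /eqP <-.
rewrite (exchange_big_dep xpredT)//=; apply: eq_bigr => y _.
rewrite -big_filter (eq_filter (a2 := pred1 (pooled_atom y))); last first.
  by move=> x /=; rewrite eq_sym.
rewrite filter_pred1_uniq ?big_seq1 ?fset_uniq//.
by apply/imfset2P; exists y.1 => //; exists y.2.
Qed.

Variables (m : nat) (f : 'rV[R]_d -> 'rV[R]_m).

Let val (c : 'I_n -> 'rV[R]_m) : R :=
  \sum_j \sum_x pooled_weight j x * norm2 (f (pooled_atom x) - c j) `^ p.

Let val_set : [set v : R | exists c : 'I_n -> 'rV[R]_m,
    v = k%:R^-1 * \sum_(j < n) \sum_(x <- C j) w j x * norm2 (f x - c j) `^ p] =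
  [set v : R | exists c, v = k%:R^-1 * val c].
Proof.
have valE (c : 'I_n -> 'rV[R]_m) :
    \sum_(j < n) \sum_(x <- C j) w j x * norm2 (f x - c j) `^ p = val c.
  by apply: eq_bigr => j _; exact: (solution_sum j (fun x => norm2 (f x - c j) `^ p)).
by apply/seteqP; split => _ [c ->]; exists c; rewrite valE.
Qed.

Lemma image_cost_le c : image_cost k p f C w <= k%:R^-1 * val c.
Proof.
rewrite /image_cost val_set; apply: ge_inf; last by exists c.
exists 0 => _ [c' ->]; rewrite mulr_ge0 ?invr_ge0//.
by do 2!apply: sumr_ge0 => ? _; rewrite mulr_ge0 ?powR_ge0// g_ge0.
Qed.

Lemma le_image_cost b : (forall c, b <= k%:R^-1 * val c) -> b <= image_cost k p f C w.
Proof.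
move=> hb; rewrite /image_cost val_set; apply: lb_le_inf.
  by exists (k%:R^-1 * val (fun=> 0)); exists (fun=> 0).
by move=> _ [c ->].
Qed.

End Costs.

(** * Both inequalities for one solution *)

Section SolutionTransfer.
Variables (R : realType) (d m n k : nat) (p eps : R).
Variables (mus : 'I_k -> discrete_dist R d n) (f : 'rV[R]_d -> 'rV[R]_m).
Variables (s : 'I_n -> 'I_k * 'I_n) (a : 'I_k * 'I_n -> 'I_n).
Variable good : pred ('I_k * 'I_n).

Let pt := pooled_atom mus.
Let v x := f (pt x).
Let W (x : 'I_k * 'I_n) := mass (mus x.1) x.2.
Let r0 x := norm2 (pt x - pt (s (a x))).
Let rho x := W x * r0 x `^ p.
Let h := eps `^ p.

Hypothesis n0 : (0 < n)%N.
Hypothesis p1 : 1 <= p.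
Hypothesis eps_gt0 : 0 < eps.
Hypothesis eps_lt : eps < 1 / 4.
Hypothesis reference : forall (w : 'I_n -> 'I_k * 'I_n -> R) c,
  (forall j x, 0 <= w j x) -> (forall x, \sum_j w j x = W x) ->
  \sum_x rho x <= 2 `^ p * \sum_j \sum_x w j x * norm2 (pt x - c j) `^ p.
Hypothesis sparse :
  sparsely_distorted eps (h ^+ 25 / n%:R ^+ 2) rho a s good pt v.
Hypothesis bad_mass :
  \sum_(x | ~~ good x) W x * (r0 x + norm2 (v x - v (s (a x)))) `^ p <=
  h ^+ 7 * \sum_x rho x.

(** [cluster_transfer] is applied in both directions, then the infimum over the centers is taken.
    The additive error is at most [eps * cost k p C w], by comparison with the reference
    clustering. *)
Lemma solution_cost_transfer C w : is_solution mus p C w ->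
  image_cost k p f C w <= (1 + eps) `^ (3 * p) * cost k p C w /\
  (1 - eps) * cost k p C w <= (1 + eps) `^ (3 * p - 1) * image_cost k p f C w.
Proof.
move=> [nu [g [gopt wE CE]]].
have e0 := eps_gt0; have e1 := eps_lt; have hp := p1.
have g_ge0 i b j : 0 <= g i b j by have [[]] := gopt i.
have pw_ge0 j x : 0 <= pooled_weight g j x by exact: g_ge0.
have pw_sum x : \sum_j pooled_weight g j x = W x by have [[_ gs _] _] := gopt x.1; exact: gs.
have r0_ge0 x : 0 <= r0 x by exact: norm2_ge0.
have [_ good_center _] := sparse.
have good_r0 x : good x -> r0 x <= (1 + eps) * r0 x.
  by move=> _; rewrite ler_peMl//; lra.
have good_rv x : good x -> norm2 (v x - v (s (a x))) <= (1 + eps) * r0 x.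
  by move=> gx; have /andP[] := good_center x (a x) gx.
have bad_massC : \sum_(x | ~~ good x) W x * (norm2 (v x - v (s (a x))) + r0 x) `^ p <=
    h ^+ 7 * \sum_x rho x.
  by under eq_bigr do rewrite addrC.
have fwd := cluster_transfer n0 p1 eps_gt0 eps_lt sparse pw_ge0 pw_sum r0_ge0
  good_r0 good_rv bad_mass.
have bwd := cluster_transfer n0 p1 eps_gt0 eps_lt (sparsely_distortedC sparse)
  pw_ge0 pw_sum r0_ge0 good_rv good_r0 bad_massC.
have up := image_cost_le p g_ge0 wE CE.
have lo m' (f' : 'rV[R]_d -> 'rV[R]_m') b :=
  @le_image_cost R d n k p mus C w g g_ge0 wE CE m' f' b.
have ki : 0 <= k%:R^-1 :> R by rewrite invr_ge0.
set M := (1 + eps) `^ (3 * p - 1).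
have M0 : 0 < M by rewrite powR_gt0//; lra.
have ME : M * (1 + eps) = (1 + eps) `^ (3 * p).
  rewrite /M mulrC mulr_powRB1//; lra.
have M1 : 1 <= M by rewrite -(powRr0 (1 + eps)) ler_powR//; lra.
have t0 : 0 < 2 `^ p :> R by rewrite powR_gt0.
have rhoK : k%:R^-1 * (eps / 2 `^ p * \sum_x rho x) <= eps * cost k p C w.
  have et : 0 <= eps / 2 `^ p by rewrite divr_ge0// ltW.
  rewrite -ler_pdivrMl//; apply: lo => c.
  rewrite mulrCA; apply: ler_wpM2l => //.
  rewrite ler_pdivrMl// mulrAC ler_pdivrMr// -mulrA ler_pM2l// mulrC.
  exact: reference.
split.
  (* The factor [M + eps] is at most [M * (1 + eps)], since [1 <= M]; this raises the exponent to
     [3 * p]. *)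
  suff : image_cost k p f C w / (M + eps) <= cost k p C w.
    rewrite ler_pdivrMr; last lra.
    move=> hl; apply: le_trans hl _; rewrite mulrC -ME ler_wpM2r//.
      by apply: lo => c; rewrite mulr_ge0//; do 2!apply: sumr_ge0 => ? _; rewrite mulr_ge0// powR_ge0.
    by rewrite mulrDr mulr1 lerD2l ler_peMl// ltW.
  apply: lo => c; rewrite ler_pdivrMr; last lra.
  have [z hz] := fwd c.
  apply: le_trans (up _ f z) _.
  apply: le_trans (ler_wpM2l ki hz) _.
  rewrite mulrDr [k%:R^-1 * (M * _)]mulrCA [leRHS]mulrC mulrDl lerD2l.
  apply: le_trans rhoK _; rewrite ler_pM2l//.
  exact: (up _ id c).
(* Backwards, the error is a multiple of the left-hand cost itself, whence the factor [1 - eps]. *)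
rewrite -ler_pdivrMl//; apply: lo => c.
rewrite ler_pdivrMl// mulrBl mul1r lerBlDr.
have [z hz] := bwd c.
apply: le_trans (up _ id z) _.
apply: le_trans (ler_wpM2l ki hz) _.
by rewrite mulrDr [k%:R^-1 * (_ * _)]mulrCA lerD2l.
Qed.

End SolutionTransfer.

(** * Choice of the dimension and conclusion *)

Lemma dimension_bound (R : realType) (c c' p eps delta : R) (n m : nat) :
  0 < c -> 0 < c' -> 1 <= p -> 0 < eps -> eps < 1 / 4 -> 0 < delta -> delta < 1 ->
  (0 < n)%N ->
  (35 / c + c') * ((ln (n%:R / delta) + p * ln (1 / eps) + p ^+ 2) / eps ^+ 2) <= m%:R ->
  c' * p / eps ^+ 2 <= m%:R /\
  expR (- (c * eps ^+ 2 * m%:R)) * (n%:R ^+ 3 * (eps `^ p)^-1 ^+ 35) <= delta.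
Proof.
move=> c0 c'0 p1 e0 e1 d0 d1 n0.
have N1 : (1 : R) <= n%:R by rewrite ler1n.
have N0 : (0 : R) < n%:R by lra.
set L1 := ln (n%:R / delta); set L2 := p * ln (1 / eps).
have L1_ge0 : 0 <= L1.
  by rewrite ln_ge0// ler_pdivlMr// mul1r; lra.
have L2_ge0 : 0 <= L2.
  rewrite mulr_ge0//; first lra.
  by rewrite ln_ge0// ler_pdivlMr// mul1r; lra.
have es : 0 < eps ^+ 2 by rewrite exprn_gt0.
rewrite mulrA ler_pdivrMr// => hm.
have p2 : p <= p ^+ 2 by rewrite expr2 ler_peMr//; lra.
have c35 : 0 < 35 / c by rewrite divr_gt0.
set L := L1 + L2 + p ^+ 2 in hm.
have Lp : p <= L by rewrite /L; lra.
have hm1 : c' * L <= m%:R * eps ^+ 2.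
  apply: le_trans hm; rewrite ler_wpM2r//; lra.
have hm2 : 35 * L <= c * eps ^+ 2 * m%:R.
  have h : 35 / c * L <= m%:R * eps ^+ 2.
    apply: le_trans hm; rewrite ler_wpM2r//; lra.
  have := ler_wpM2l (ltW c0) h.
  by rewrite mulrA mulrCA divff ?gt_eqF// mulr1; lra.
split.
  rewrite ler_pdivrMr//; apply: le_trans hm1.
  by rewrite ler_pM2l.
(* The summand [35 / c] of the constant yields 35 copies of both logarithms, matching the exponent
   of [h^-1] in the failure bound; the summand [c'] served the threshold on [m]. *)
have q_le : expR (- (c * eps ^+ 2 * m%:R)) <= (delta / n%:R) ^+ 35 * (eps `^ p) ^+ 35.
  apply: (@le_trans _ _ (expR (35%:R * - (L1 + L2)))).
    have p20 : 0 <= p ^+ 2 by exact: sqr_ge0.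
    by rewrite ler_expR; move: hm2; rewrite /L; lra.
  rewrite expRM_natl opprD expRD exprMn le_eqVlt; apply/orP; left; apply/eqP.
  have nd : 0 < n%:R / delta by rewrite divr_gt0.
  congr (_ ^+ _ * _ ^+ _); first by rewrite expRN lnK ?posrE// invf_div.
  by rewrite /powR gt_eqF// /L2 div1r lnV ?posrE// mulrN opprK.
have h0 : 0 < eps `^ p by rewrite powR_gt0.
have X0 : 0 <= n%:R ^+ 3 * (eps `^ p)^-1 ^+ 35.
  by rewrite mulr_ge0 ?exprn_ge0 ?invr_ge0 ?(ltW h0)// ltW.
apply: le_trans (ler_wpM2r X0 q_le) _.
(* The powers of [eps] cancel; beyond one [delta] only factors at most 1 are left. *)
have -> : (delta / n%:R) ^+ 35 * eps `^ p ^+ 35 * (n%:R ^+ 3 * (eps `^ p)^-1 ^+ 35) =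
    delta * (delta ^+ 34 * n%:R^-1 ^+ 32).
  have -> : (delta / n%:R) ^+ 35 * eps `^ p ^+ 35 * (n%:R ^+ 3 * (eps `^ p)^-1 ^+ 35) =
    (delta / n%:R) ^+ 35 * n%:R ^+ 3 * (eps `^ p * (eps `^ p)^-1) ^+ 35.
    by rewrite exprMn; ring.
  have N3 : n%:R^-1 ^+ 3 * n%:R ^+ 3 = 1 :> R.
    by rewrite -exprMn mulVf ?gt_eqF// expr1n.
  rewrite divff ?gt_eqF// expr1n mulr1.
  transitivity (delta * (delta ^+ 34 * n%:R^-1 ^+ 32) * (n%:R^-1 ^+ 3 * n%:R ^+ 3)).
    by set y := n%:R^-1; ring.
  by rewrite N3 mulr1.
rewrite ler_piMr ?(ltW d0)// mulr_ile1 ?exprn_ge0 ?exprn_ile1 ?invr_ge0 ?(ltW d0) ?(ltW d1) ?(ltW N0)//.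
by rewrite invf_le1.
Qed.

Unset Implicit Arguments.

Theorem theorem17 (R : realType) (c c' : R) (hc : 0 < c) (hc' : 0 < c') :
  exists2 K : R, 0 < K &
  forall (p eps delta : R) (d n k m : nat)
    (mus : 'I_k -> discrete_dist R d n)
    (disp : measure_display) (T : measurableType disp) (P : probability T R)
    (pi : T -> 'rV[R]_d -> 'rV[R]_m),
  1 <= p -> 0 < eps < 1 / 4 -> 0 < delta < 1 -> (0 < k)%N ->
  K * ((ln (n%:R / delta) + p * ln (1 / eps) + p ^+ 2) / eps ^+ 2) <= m%:R ->
  standard_dim_reduction P c c' eps p pi ->
  exists E : set T,
    [/\ measurable E, ((1 - delta)%:E <= P E)%E &
     forall t, E t ->
     forall (C : 'I_n -> {fset 'rV[R]_d}) (w : 'I_n -> 'rV[R]_d -> R),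
     is_solution mus p C w ->
       image_cost k p (pi t) C w <= (1 + eps) `^ (3 * p) * cost k p C w /\
       (1 - eps) * cost k p C w <=
         (1 + eps) `^ (3 * p - 1) * image_cost k p (pi t) C w].
Proof.
exists (35 / c + c'); first by rewrite addr_gt0// divr_gt0.
move=> p eps delta d n k m mus disp T P pi p1 /andP[e0 e1] /andP[d0 d1] k0 hm [mpi hpi].
pose i0 : 'I_k := Ordinal k0.
(* The masses of the distribution [mus i0] sum to 1, so it has an atom. *)
have n0 : (0 < n)%N.
  rewrite lt0n; apply/eqP => n0; have := mass_sum1 (mus i0).
  by subst n; rewrite big_ord0 => /eqP; rewrite eq_sym oner_eq0.
have [hm' hq] := dimension_bound hc hc' p1 e0 e1 d0 d1 n0 hm.
have [delta' [alpha [hd ha hred]]] := hpi hm'.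
pose W (x : 'I_k * 'I_n) := mass (mus x.1) x.2.
have [s [a ref]] :=
  reference_clustering (pooled_atom mus) W (i0, Ordinal n0) n0 p1.
(* The event depends on the atoms and the reference clustering, both fixed before any solution; this
   gives the uniformity. *)
have [E [mE PE Eg]] := @good_event R _ _ P _ _ _ pi _ (pooled_atom mus) W s a
  p eps delta _ _ _ n0 p1 e0 e1 (fun x => ltW (mass_gt0 _ x.2)) mpi hred hd ha
  (expR_ge0 _) hq.
exists E; split=> // t Et C w sol; have [good sp bad] := Eg t Et.
exact: (solution_cost_transfer n0 p1 e0 e1 ref sp bad sol).
Qed.
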